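(* For every $\alpha>0$ and $\Delta>0$ there exists $\delta=\delta(\alpha,\Delta)>0$ such that for every sufficiently large integer $n$ the following holds. If $b\le \frac{\delta n}{\log n}$, then in the $(1:b)$ Maker-Breaker game played on $E(K_n)$, Maker has a strategy to build a graph which contains a copy of every spanning tree $T$ (tree on $n$ vertices) such that (i) $\Delta(T)\le\Delta$, and (ii) $T$ has a bare path of length at least $\alpha n$.
   Context: In a $(1:b)$ Maker-Breaker game on the board $E(K_n)$, Maker and Breaker alternately claim previously unclaimed edges of $K_n$, Maker one edge per turn and Breaker $b$ edges per turn; Maker's graph is the graph formed by the edges he claims. A bare path in a tree $T$ is a path all of whose interior vertices have degree exactly two in $T$. $\Delta(T)$ denotes the maximum degree of $T$. *)

(* Defs.v *)
From mathcomp Require Import all_boot all_order all_algebra.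
From mathcomp Require Import reals exp.

Set Implicit Arguments.
Unset Strict Implicit.
Unset Printing Implicit Defensive.

Definition simple_graph (V : finType) (G : rel V) : Prop :=
  symmetric G /\ irreflexive G.

Definition connected_graph (V : finType) (G : rel V) : Prop :=
  (0 < #|V|) /\ forall x y : V, connect G x y.

(* Sizes 0, 1, 2 are excluded: [:: x; y] is a [ucycle] as soon as xy is an
   edge, but it is not a cycle of the graph. *)
Definition acyclic_graph (V : finType) (G : rel V) : Prop :=
  forall c : seq V, 2 < size c -> ~ ucycle G c.

Definition is_tree (V : finType) (T : rel V) : Prop :=
  [/\ simple_graph T, connected_graph T & acyclic_graph T].

Definition degree (V : finType) (G : rel V) (x : V) : nat := #|[set y | G x y]|.

Definition max_degree (V : finType) (G : rel V) : nat := \max_(x : V) degree G x.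

(* The path has vertex sequence [x :: p], hence length (number of edges)
   [size p]; [behead (belast x p)] lists its interior vertices. *)
Definition bare_path (V : finType) (T : rel V) (x : V) (p : seq V) : Prop :=
  [/\ path T x p, uniq (x :: p)
    & {in behead (belast x p), forall y, degree T y = 2}].

Definition contains_copy (V W : finType) (G : rel W) (H : rel V) : Prop :=
  exists2 f : V -> W, injective f & {homo f : x y / H x y >-> G x y}.

Definition board (n : nat) : {set {set 'I_n}} := [set e : {set 'I_n} | #|e| == 2].

Definition edge_graph (n : nat) (E : {set {set 'I_n}}) : rel 'I_n :=
  [rel x y | [set x; y] \in E].

Variant player := Maker | Breaker.

Record position (n : nat) := Position {
  maker_edges : {set {set 'I_n}};
  breaker_edges : {set {set 'I_n}} }.

Definition unclaimed (n : nat) (q : position n) : {set {set 'I_n}} :=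
  board n :\: (maker_edges q :|: breaker_edges q).

(* A strategy of Maker sees the current position and the list of all earlier
   ones, most recent first. *)
Definition strategy (n : nat) := position n -> seq (position n) -> {set 'I_n}.

(* [play b starter s t q h]: following [s], Maker can be led to position [q]
   after the earlier positions [h], and player [t] is to move.  Breaker claims
   exactly [b] edges, or all the remaining ones if there are fewer than [b]. *)
Inductive play (n b : nat) (starter : player) (s : strategy n) :
    player -> position n -> seq (position n) -> Prop :=
| play_start : play b starter s starter (Position set0 set0) [::]
| play_maker q h : play b starter s Maker q h -> s q h \in unclaimed q ->
    play b starter s Breaker
      (Position (s q h |: maker_edges q) (breaker_edges q)) (q :: h)
| play_breaker q h (F : {set {set 'I_n}}) : play b starter s Breaker q h ->
    unclaimed q != set0 -> F \subset unclaimed q ->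
    #|F| = minn b #|unclaimed q| ->
    play b starter s Maker
      (Position (maker_edges q) (F :|: breaker_edges q)) (q :: h).

(* [play] only contains legal moves, so the first clause is needed: it rules
   out strategies that get stuck before the board is exhausted. *)
Definition maker_can_build (n b : nat) (starter : player)
    (P : rel 'I_n -> Prop) : Prop :=
  exists s : strategy n,
    (forall q h, play b starter s Maker q h -> unclaimed q != set0 ->
       s q h \in unclaimed q) /\
    (forall t q h, play b starter s t q h -> unclaimed q = set0 ->
       P (edge_graph (maker_edges q))).

(* Main.v *)
Require Import Defs.
From mathcomp Require Import all_boot all_order all_algebra.
From mathcomp Require Import reals exp boolp.
From mathcomp Require Import zify ring lra.
Import Order.TTheory GRing.Theory Num.Theory.

Set Implicit Arguments.
Unset Strict Implicit.
Unset Printing Implicit Defensive.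

(** Beck's criterion: Maker can claim an element of every set of a family
    [(A_i)] as soon as [sum_i (1 + 1/(2b+2)) ^ (- #|A_i|) < 1/2].  For
    [b <= delta n / log n] this allows [2 ^ (C k log n)] sets of size [c k n],
    for each [k], and [2 ^ (C n log n)] sets of size [c n ^ 2], with [C / c] as
    large as we like.  Three families are used, where [m] is a small linear
    fraction of [n] and the vertex set is split into a reserve [B] and its
    complement.
    - The edges from [X] to the part of [B], or of its complement, outside
      [X] and a set [Y] with [#|Y| <= d #|X|]: hitting them makes every set of
      at most [2 m] vertices expand by a factor [d] into both sides.
    - For every sparse graph [J], the edges that join a positive fraction of the
      pairs of disjoint [m]-sets not joined by [J]: greedily, Maker's graph
      contains a graph with [O(n)] edges joining all such pairs.
    - For every graph [O] with [O(n)] edges, vertex set [W] and vertices [x], [y],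
      the pairs of ends of longest paths of [O] in [W] that use the extra edge
      [xy], provided they are quadratically many.

    Given a tree with a long bare path from [x] to [y], the Friedman-Pippenger
    argument embeds the tree without the interior of that path outside [B].
    The uncovered vertices contain [B], so an edge-minimal expanding subgraph
    containing [J] is a sparse expander on them.  Posa rotations that never cut
    [xy] give it quadratically many boosters, of which Maker owns one; it closes a
    longest path into a cycle through [xy], and with one more edge leaving the
    cycle the longest path grows while the graph stays sparse.  After at most [n]
    rounds the uncovered vertices carry a spanning path from the image of [x] to
    the image of [y]. *)

(** * The hitting game *)

Lemma disjointsU1r (T : finType) (x : T) (A S : {set T}) :
  [disjoint A & x |: S] = (x \notin A) && [disjoint A & S].
Proof.
by rewrite -!setI_eq0 setIUr setU_eq0 !setI_eq0 disjoint_sym disjoints1.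
Qed.

Section HittingGame.

Local Open Scope ring_scope.

Variable b : nat.

(** The factor by which each edge of a set claimed by Breaker raises the weight of that set. It is
    small enough for a whole turn of Breaker to act almost linearly, yet [2 * b.+1] factors already
    amount to 2. *)
Definition growth : rat := 1 + (2 * b.+1%:R)^-1.

Lemma growth_ge1 : 1 <= growth.
Proof. by rewrite lerDl invr_ge0 mulr_ge0 ?ler0n. Qed.

Lemma growth_gt0 : 0 < growth.
Proof. exact: lt_le_trans ltr01 growth_ge1. Qed.

(** Induction on [j]: the cross term created by one more factor is at most half of [1 / b.+1], since
    [j / b.+1 <= 1]. The 2 in [growth] leaves exactly this half free. *)
Lemma growth_exp_le j : (j <= b.+1)%N -> growth ^+ j <= 1 + j%:R / b.+1%:R.
Proof.
elim: j => [|j IHj] le_j; first by rewrite expr0 mul0r addr0.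
have c_gt0 : 0 < b.+1%:R :> rat by rewrite ltr0n.
have le_jc : j%:R / b.+1%:R <= 1 :> rat.
  by rewrite ler_pdivrMr // mul1r ler_nat ltnW.
rewrite exprSr; apply: le_trans (_ : (1 + j%:R / b.+1%:R) * growth <= _).
  by rewrite ler_pM2r ?growth_gt0 // IHj // ltnW.
rewrite /growth invfM -(natr1 j) [in leRHS]mulrDl.
set t := _ / _ in le_jc *; set u := _^-1 in t le_jc *.
have u_gt0 : 0 < u by rewrite invr_gt0.
have : t * u <= 1 * u by rewrite ler_wpM2r // ltW.
rewrite [_ * (1 + _)](_ : _ = 1 + t + u / 2 + (t * u) / 2); last by field.
by lra.
Qed.

(** Bernoulli's inequality, applied to [2 * b.+1] factors at a time. *)
Lemma growth_exp_ge j : 2 ^+ j <= growth ^+ (2 * b.+1 * j).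
Proof.
have g_ge0 : 0 <= growth by exact: ltW growth_gt0.
rewrite exprM; apply: lerXn2r; rewrite ?nnegrE ?exprn_ge0 //.
have bern (x : rat) k : 0 <= x -> 1 + k%:R * x <= (1 + x) ^+ k.
  move=> x0; elim: k => [|k IHk]; first by rewrite expr0 mul0r addr0.
  rewrite exprS -natr1.
  have : 0 <= k%:R * x by rewrite mulr_ge0 ?ler0n.
  nra.
have h : 0 <= (2 * b.+1%:R : rat)^-1 by rewrite invr_ge0 mulr_ge0.
have := bern _ (2 * b.+1)%N h; have cn : (2 * b.+1%:R : rat) != 0 by rewrite mulf_neq0 ?pnatr_eq0.
by rewrite /growth natrM mulfV.
Qed.

Definition decay : rat := growth^-1.

Lemma decay_gt0 : 0 < decay. Proof. by rewrite invr_gt0 growth_gt0. Qed.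
Lemma decay_le1 : decay <= 1. Proof. by rewrite invf_le1 ?growth_gt0 // growth_ge1. Qed.

Lemma decay_exp_le k j : (2 * b.+1 * j <= k)%N -> decay ^+ k <= (2 ^+ j)^-1.
Proof.
move=> le_jk; apply: le_trans (_ : decay ^+ (2 * b.+1 * j) <= _).
  by rewrite ler_wiXn2l ?decay_le1 // ltW // decay_gt0.
by rewrite exprVn lef_pV2 ?posrE ?exprn_gt0 ?growth_gt0 // growth_exp_ge.
Qed.

Variables (n : nat) (I : finType) (P : pred I) (A : I -> {set {set 'I_n}}).

(** A set claimed entirely by Breaker has weight 1. The potential sums over the sets that Maker has
    not hit yet, so none of them is lost while it stays below 1. *)
Definition weight (E : {set {set 'I_n}}) (i : I) : rat := decay ^+ #|A i :\: E|.

Definition potential (q : position n) : rat :=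
  \sum_(i | P i && [disjoint A i & maker_edges q]) weight (breaker_edges q) i.

Definition danger (q : position n) (e : {set 'I_n}) : rat :=
  \sum_(i | P i && [disjoint A i & maker_edges q] && (e \in A i))
     weight (breaker_edges q) i.

Lemma weight_ge0 E i : 0 <= weight E i.
Proof. by rewrite exprn_ge0 // ltW // decay_gt0. Qed.

Lemma danger_ge0 q e : 0 <= danger q e.
Proof. by apply: sumr_ge0 => i _; apply: weight_ge0. Qed.

Lemma danger_le_potential q e : danger q e <= potential q.
Proof.
rewrite /potential (bigID (fun i => e \in A i)) /= lerDl.
by apply: sumr_ge0 => i _; apply: weight_ge0.
Qed.

Lemma maker_move_potential q e :
  potential (Position (e |: maker_edges q) (breaker_edges q)) =
  potential q - danger q e.
Proof.
rewrite /potential [in RHS](bigID (fun i => e \in A i)) /=.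
rewrite -/(danger q e) addrAC subrr add0r.
apply: eq_bigl => i; rewrite -andbA; congr andb.
by rewrite disjointsU1r andbC.
Qed.

Lemma maker_move_danger q e f :
  danger (Position (e |: maker_edges q) (breaker_edges q)) f <= danger q f.
Proof.
rewrite /danger /= [leRHS](bigID (fun i => e \in A i)) /= addrC.
rewrite [X in _ <= X + _](_ : _ = danger (Position (e |: maker_edges q) (breaker_edges q)) f).
  by rewrite lerDl; apply: sumr_ge0 => i _; apply: weight_ge0.
apply: eq_bigl => i /=.
rewrite disjointsU1r.
by case: (P i); case: (e \in _); case: (f \in _); case: [disjoint _ & _].
Qed.

(* The exponential growth of a weight over one turn of Breaker is bounded by
   a function linear in the number of claimed elements of the set. *)
Lemma breaker_move_potential q (F : {set {set 'I_n}}) (w : rat) :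
  F \subset unclaimed q -> (#|F| <= b)%N -> 0 <= w ->
  (forall f, f \in F -> danger q f <= w) ->
  potential (Position (maker_edges q) (F :|: breaker_edges q)) <= potential q + w.
Proof.
move=> sFu leFb w_ge0 dF.
have c_gt0 : 0 < b.+1%:R :> rat by rewrite ltr0n.
apply: le_trans (_ : potential q + (\sum_(f in F) danger q f) / b.+1%:R <= _); last first.
  rewrite lerD2l ler_pdivrMr //; apply: le_trans (ler_sum _ dF) _.
  by rewrite sumr_const -[_ *+ _]mulr_natr ler_wpM2l // ler_nat ltnW.
have -> : \sum_(f in F) danger q f =
    \sum_(i | P i && [disjoint A i & maker_edges q])
      #|A i :&: F|%:R * weight (breaker_edges q) i.
  rewrite /danger.
  rewrite (exchange_big_dep (fun i => P i && [disjoint A i & maker_edges q])) /=; last first.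
    by move=> f i _ /andP[].
  rewrite [RHS]big_mkcond [LHS]big_mkcond; apply: eq_bigr => i _.
  case: ifP => // Pi; rewrite sumr_const mulr_natl; congr (_ *+ _).
  by apply: eq_card => f; rewrite !inE Pi andbC.
rewrite mulr_suml -big_split /=; apply: ler_sum => i _.
have -> : weight (F :|: breaker_edges q) i =
    growth ^+ #|A i :&: F| * weight (breaker_edges q) i.
  rewrite /weight.
  have -> : #|A i :\: breaker_edges q| =
      (#|A i :&: F| + #|A i :\: (F :|: breaker_edges q)|)%N.
    rewrite -(cardsID F); congr (_ + _)%N; apply: eq_card => f; rewrite !inE.
      have := subsetP sFu f; rewrite !inE; case: (f \in F) => [/(_ isT)|_].
        by case: (f \in breaker_edges q) => //; rewrite ?orbT // andbT.
      by rewrite !andbF.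
    by rewrite negb_or andbA.
  by rewrite exprD mulrA -exprMn mulfV ?expr1n ?mul1r // gt_eqF // growth_gt0.
rewrite mulrAC -{2}[weight _ _]mul1r -mulrDl ler_wpM2r ?weight_ge0 //.
apply: growth_exp_le; apply: leq_trans (leqW leFb).
by apply: subset_leq_card; apply: subsetIr.
Qed.

(** The default [set0] is played only when no edge is free, hence never in an actual turn. *)
Definition greedy_strategy : strategy n := fun q _ =>
  if [pick e in unclaimed q] is Some e0
  then [arg max_(e > e0 in unclaimed q) danger q e]%O else set0.

Lemma greedy_strategyP (q : position n) h : unclaimed q != set0 ->
  greedy_strategy q h \in unclaimed q /\
  forall f, f \in unclaimed q -> danger q f <= danger q (greedy_strategy q h).
Proof.
move=> /set0Pn[e1 e1P]; rewrite /greedy_strategy.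
case: pickP => [e0 e0P|/(_ e1)]; last by rewrite e1P.
by case: Order.TotalTheory.arg_maxP => // e eP emax.
Qed.

Lemma unclaimed_maker (q : position n) e :
  unclaimed (Position (e |: maker_edges q) (breaker_edges q)) \subset unclaimed q.
Proof.
by apply: setDS; rewrite /=; apply: setSU; apply: subsetUr.
Qed.

Lemma maker_hits (starter : player) :
  (forall i, P i -> A i \subset board n) ->
  \sum_(i | P i) decay ^+ #|A i| < 2^-1 ->
  maker_can_build b starter (fun G : rel 'I_n => symmetric G /\
    forall i, P i -> exists u v, G u v /\ [set u; v] \in A i).
Proof.
move=> sAb small; exists greedy_strategy.
have pot0 : potential (Position set0 set0) < 2^-1.
  apply: le_lt_trans small; rewrite /potential /= [leRHS](bigID (fun i => [disjoint A i & set0])) /=.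
  rewrite [X in _ <= X + _](eq_bigr (weight set0)); last by move=> i _; rewrite /weight setD0.
  by rewrite lerDl; apply: sumr_ge0 => i _; rewrite exprn_ge0 // ltW // decay_gt0.
(* When Breaker is to move, potential plus any available danger is below 1. At the start this
   follows from danger at most potential and potential below 1/2. Breaker's turn then adds at most
   the largest danger, and Maker's answer removes the largest danger of the new position, which
   restores the invariant. *)
have inv t q h : play b starter greedy_strategy t q h -> potential q < 1 /\
    (t = Breaker -> forall f, f \in unclaimed q -> potential q + danger q f < 1).
  elim=> [|{}q {}h _ [IH _] sP|{}q {}h F _ [_ IH] u0 sF cF].
  - split=> [|_ f _]; first by apply: lt_trans pot0 _.
    by have := danger_le_potential (Position set0 set0) f; lra.
  - have un0 : unclaimed q != set0 by apply/set0Pn; exists (greedy_strategy q h).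
    have [eP emax] := greedy_strategyP h un0.
    rewrite maker_move_potential; split=> [|_ f fP].
      by have := danger_ge0 q (greedy_strategy q h); lra.
    have := maker_move_danger q (greedy_strategy q h) f.
    by have := emax f (subsetP (unclaimed_maker _ _) _ fP); lra.
  - split=> //; have [e0 e0P] := set0Pn _ u0.
    have lt1 f : f \in unclaimed q -> danger q f < 1 - potential q.
      by move=> fP; have := IH erefl f fP; lra.
    pose w := danger q [arg max_(e > e0 in unclaimed q) danger q e]%O.
    have [w1 wmax] : w < 1 - potential q /\ (forall f, f \in unclaimed q -> danger q f <= w).
      by rewrite /w; case: Order.TotalTheory.arg_maxP => // e eP emax; split; [apply: lt1|].
    apply: le_lt_trans (_ : potential q + w < 1); last by lra.
    apply: breaker_move_potential => //; first by rewrite cF geq_minl.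
      exact: danger_ge0.
    by move=> f /(subsetP sF) /wmax.
split=> [q h _ un0|t q h /inv[invq _] un0]; first by case: (greedy_strategyP h un0).
split=> [u v|i Pi]; first by rewrite /edge_graph /= setUC.
have /pred0Pn[e /andP[eA eM]] : ~~ [disjoint A i & maker_edges q].
  (* On an exhausted board a set missed by Maker belongs to Breaker and contributes 1 to the
     potential. *)
  apply/negP => dis; move: invq; apply/negP; rewrite -leNgt.
  rewrite /potential (bigD1 i) ?Pi //= /weight.
  have -> : A i :\: breaker_edges q = set0.
    apply/setP => e; rewrite !inE andbC; apply/negbTE/negP => /andP[eA eB].
    have eb := subsetP (sAb i Pi) e eA; rewrite inE in eb.
    have : e \in unclaimed q by rewrite !inE negb_or eB (disjointFr dis eA) eb.
    by rewrite un0 inE.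
  by rewrite cards0 expr0 lerDl; apply: sumr_ge0 => j _; apply: weight_ge0.
have /cards2P[u [v [_ def_e]]] : #|e| == 2%N by have := subsetP (sAb i Pi) e eA; rewrite inE.
by exists u, v; rewrite /edge_graph /= -def_e.
Qed.
End HittingGame.

(** * Expansion, tight sets and sparse expanders *)

Section Neighbourhoods.

Variables (V : finType) (e : rel V).
Implicit Types (C X Y S : {set V}) (w : V -> nat).

(** Neighbours lying in [X] itself are counted; the external neighbourhood is the case
    [C = ~: X]. *)
Definition nbh C X : {set V} := [set z in C | [exists x in X, e x z]].

Lemma nbhP C X z : reflect (z \in C /\ exists2 x, x \in X & e x z) (z \in nbh C X).
Proof.
rewrite inE; apply: (iffP andP) => [[zC /existsP[x /andP[xX xz]]]|[zC [x xX xz]]].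
  by split=> //; exists x.
by split=> //; apply/existsP; exists x; rewrite xX.
Qed.

Lemma nbhU C X Y : nbh C (X :|: Y) = nbh C X :|: nbh C Y.
Proof.
apply/setP => z; rewrite in_setU; apply/nbhP/orP => [[zC [x]]|].
  by rewrite inE => /orP[] xX xz; [left|right]; apply/nbhP; split=> //; exists x.
by case=> /nbhP[zC [x xX xz]]; split=> //; exists x; rewrite // inE xX ?orbT.
Qed.

Lemma nbhS C X Y : X \subset Y -> nbh C X \subset nbh C Y.
Proof. by move=> sXY; rewrite -(setUidPr sXY) nbhU subsetUl. Qed.

Lemma nbh_submodular C X Y :
  #|nbh C (X :|: Y)| + #|nbh C (X :&: Y)| <= #|nbh C X| + #|nbh C Y|.
Proof.
rewrite nbhU -[leqRHS]cardsUI leq_add2l subset_leq_card // subsetI.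
by rewrite !nbhS ?subsetIl ?subsetIr.
Qed.

Lemma sum_setUI w X Y :
  \sum_(x in X :|: Y) w x + \sum_(x in X :&: Y) w x =
  \sum_(x in X) w x + \sum_(x in Y) w x.
Proof.
rewrite (big_setID X) /= setUK setDUl setDv set0U [in RHS](big_setID X (A := Y)) /=.
by rewrite setIC; lia.
Qed.

(* The second clause confines tight sets to sizes below [m], so that the union
   of two of them is again subject to the first clause. *)
Definition expands_over (m : nat) C w := forall X, #|X| <= 2 * m ->
  \sum_(x in X) w x <= #|nbh C X| /\
  (m <= #|X| -> \sum_(x in X) w x < #|nbh C X|).

Definition tight (m : nat) C w X := (#|X| < m) && (#|nbh C X| == \sum_(x in X) w x).

Lemma tightP m C w X : expands_over m C w -> #|X| <= 2 * m ->
  #|nbh C X| <= \sum_(x in X) w x -> tight m C w X.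
Proof.
move=> ex /ex[h1 h2] le; apply/andP; split.
  by rewrite ltnNge; apply/negP => /h2; rewrite ltnNge le.
by rewrite eqn_leq le h1.
Qed.

(** The neighbourhood size is submodular and the demand modular, while both [X :|: Y] and [X :&: Y]
    are small enough to satisfy the lower bound; hence equality holds for both. *)
Lemma tight_UI m C w X Y : expands_over m C w -> tight m C w X -> tight m C w Y ->
  tight m C w (X :|: Y) /\ tight m C w (X :&: Y).
Proof.
move=> ex /andP[ltX /eqP eqX] /andP[ltY /eqP eqY].
have := nbh_submodular C X Y; have := sum_setUI w X Y; have := cardsUI X Y.
move=> eqc eqs sub.
have leU : #|X :|: Y| <= 2 * m by lia.
have leI : #|X :&: Y| <= 2 * m by lia.
have [hU _] := ex _ leU; have [hI _] := ex _ leI.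
by split; apply: tightP => //; lia.
Qed.

Lemma nbh_set1U C s X : nbh C [set s] \subset nbh C X -> nbh C (s |: X) = nbh C X.
Proof. by move=> sub; rewrite nbhU (setUidPr sub). Qed.

Lemma nbhD1 C y X : #|nbh C X| <= (y \in nbh C X) + #|nbh (C :\ y) X|.
Proof.
rewrite (cardsD1 y) leq_add2l subset_leq_card //.
by apply/subsetP => z; rewrite !inE => /andP[-> /andP[-> ->]].
Qed.

(* One step of the Friedman-Pippenger argument: the union of the tight sets
   avoiding [s] is tight, hence cannot dominate the neighbourhood of [s]. *)
Lemma expands_over_leaf m C w s : 0 < m -> expands_over m C w -> 0 < w s ->
  exists2 y, y \in nbh C [set s] &
    forall X, #|X| <= 2 * m ->
      \sum_(x in X) (w x - (x == s)) <= #|nbh (C :\ y) X|.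
Proof.
move=> m_gt0 ex ws_gt0.
pose TS X := tight m C w X && (s \notin X).
pose U := \bigcup_(X | TS X) X.
have /andP[/andP[ltU /eqP eqU] sU] : TS U.
  apply: (big_ind TS) => //.
    rewrite /TS /tight cards0 m_gt0 big_set0 inE andbT /=; apply/eqP/eqP.
    by rewrite cards_eq0; apply/eqP/setP => z; rewrite !inE; apply/andP=> -[_ /existsP[x]]; rewrite inE.
  move=> X Y /andP[tX sX] /andP[tY sY]; apply/andP; split.
    by case: (tight_UI ex tX tY).
  by rewrite inE negb_or sX.
(* If [U] saw all neighbours of [s], adding [s] to it would raise the demand but not the
   neighbourhood, against expansion. *)
have [/subsetPn[y yN yU]|/negPn sub] := boolP (~~ (nbh C [set s] \subset nbh C U)); last first.
  have le : #|s |: U| <= 2 * m by rewrite cardsU1; case: (s \in U); lia.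
  have [] := ex _ le; rewrite nbh_set1U // big_setU1 //= eqU; lia.
(* A set [X] violating the new bound must see [y], avoid [s] and be tight. Then it is part of [U],
   although [U] does not see [y]. *)
exists y => // X leX; rewrite leqNgt; apply/negP => lt.
have hsum : \sum_(x in X) w x = \sum_(x in X) (w x - (x == s)) + (s \in X).
  have [sX|sX] := boolP (s \in X).
    rewrite [LHS](bigD1 s) //= [in RHS](bigD1 s) //= eqxx.
    have -> : \sum_(i in X | i != s) (w i - (i == s)) = \sum_(i in X | i != s) w i.
      by apply: eq_bigr => i /andP[_ /negbTE->]; rewrite subn0.
    lia.
  rewrite addn0; apply: eq_bigr => x xX; case: eqP => [xs|_]; last by rewrite subn0.
  by rewrite -xs xX in sX.
have [h _] := ex _ leX; have := nbhD1 C y X.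
case yX: (y \in nbh C X); case sX: (s \in X) hsum => /= hsum; try lia.
move=> h'; have tX : TS X by rewrite /TS sX andbT; apply: tightP => //; lia.
by move/negP: yU; case; apply: subsetP yX; apply: nbhS; apply: bigcup_sup tX.
Qed.

End Neighbourhoods.

Lemma subset_of_card (V : finType) (X : {set V}) m : m <= #|X| ->
  exists2 Y : {set V}, Y \subset X & #|Y| = m.
Proof.
case/card_geqP=> s [us <- sX]; exists [set x in s]; last by rewrite cardsE; apply/card_uniqP.
by apply/subsetP => x; rewrite inE => /sX.
Qed.

Section Joined.

Variables (V : finType) (e : rel V) (m : nat).

Definition joined := forall X Y : {set V}, [disjoint X & Y] -> #|X| = m -> #|Y| = m ->
  exists x y, [/\ x \in X, y \in Y & e x y].

(** Otherwise [m] vertices of [C] outside [X] and its neighbourhood, with [m] vertices of [X], would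
    form an unjoined pair. *)
Lemma joined_nbh (C X : {set V}) : joined -> m <= #|X| ->
  #|C| < #|nbh e C X| + #|X| + m.
Proof.
move=> jo leX; rewrite ltnNge; apply/negP => le.
have leQ : m <= #|C :\: nbh e C X :\: X|.
  have := cardsID (nbh e C X) C; have := cardsID X (C :\: nbh e C X).
  have : #|C :&: nbh e C X| <= #|nbh e C X| by rewrite subset_leq_card // subsetIr.
  have : #|(C :\: nbh e C X) :&: X| <= #|X| by rewrite subset_leq_card // subsetIr.
  lia.
have [X1 sX1 cX1] := subset_of_card leX; have [Y1 sY1 cY1] := subset_of_card leQ.
case: (jo X1 Y1) => // [|x [y [/(subsetP sX1) xX /(subsetP sY1) yY xy]]].
  rewrite disjoints_subset; apply/subsetP => x /(subsetP sX1) xX; rewrite inE.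
  by apply/negP => /(subsetP sY1); rewrite !inE xX.
move: yY; rewrite in_setD => /andP[_]; rewrite in_setD => /andP[/negP yN yC].
by case: yN; apply/nbhP; split=> //; exists x.
Qed.

End Joined.

Section SparseExpander.

Variables (V : finType) (g : rel V) (m d : nat) (B : {set V}).

Definition arc_rel (O : {set V * V}) : rel V := fun u v => (u, v) \in O.
Definition pair_rel (O : {set V * V}) : rel V := fun u v => ((u, v) \in O) || ((v, u) \in O).

Lemma nbh_arc_rel (O : {set V * V}) (X : {set V}) z :
  z \in nbh (arc_rel O) B X -> exists2 x, x \in X & (x, z) \in O.
Proof. by case/nbhP=> _. Qed.

(* In a minimal expanding set of arcs, an arc [(v, z)] comes with a tight set
   containing [v] in which only [v] sees [z]; intersecting these sets over all
   [z] bounds the out-degree of [v]. *)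
Lemma sparse_expander (J : {set V * V}) :
  0 < m -> symmetric g -> (forall X : {set V}, #|X| <= 2 * m -> d * #|X| <= #|nbh g B X|) ->
  joined (pair_rel J) m -> (forall u v, (u, v) \in J -> g u v) ->
  (2 * d + 3) * m <= #|B| ->
  exists O : {set V * V},
    [/\ #|O| <= 2 * #|J| + d * #|V|,
        forall u v, (u, v) \in O -> v \in B /\ g u v &
        forall X : {set V}, #|X| <= 2 * m -> d * #|X| <= #|nbh (arc_rel O) B X|].
Proof.
move=> m_gt0 gsym gex jo Jg leB.
(* Both orientations of [J] towards [B] are kept during the minimization, so large sets expand
   whatever is deleted. Only the other arcs need a degree bound. *)
pose J' := [set p : V * V | (p.2 \in B) && pair_rel J p.1 p.2].
have cJ' : #|J'| <= 2 * #|J|.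
  have sub : J' \subset J :|: [set (p.2, p.1) | p in J].
    apply/subsetP => -[u v]; rewrite !inE /= => /andP[_ /orP[->//|vu]].
    by apply/orP; right; apply/imsetP; exists (v, u).
  apply: leq_trans (subset_leq_card sub) _; apply: leq_trans (leq_card_setU _ _) _.
  by rewrite mul2n -addnn leq_add2l leq_imset_card.
pose P (O : {set V * V}) := (J' \subset O) &&
  [forall X : {set V}, (#|X| <= 2 * m) ==> (d * #|X| <= #|nbh (arc_rel O) B X|)].
pose O1 := [set p : V * V | (p.2 \in B) && g p.1 p.2].
have PO1 : P O1.
  apply/andP; split.
    apply/subsetP => -[u v]; rewrite !inE /= => /andP[-> /orP[/Jg//|/Jg]].
    by rewrite gsym.
  apply/forallP => X; apply/implyP => /gex h; apply: leq_trans h _.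
  apply/subset_leq_card/subsetP => z /nbhP[zB [x xX xz]]; apply/nbhP; split=> //.
  by exists x; rewrite // /arc_rel inE /= zB.
have [O /minsetP[PO Omin] sO] := minset_exists PO1.
have /andP[sJO /forallP exO] := PO.
exists O; split; first last.
- by move=> X leX; apply: (implyP (exO X)).
- by move=> u v /(subsetP sO); rewrite inE /= => /andP[-> ->].
have cst (X : {set V}) : \sum_(x in X) d = d * #|X| by rewrite sum_nat_const mulnC.
(* The strict clause for sets of at least [m] vertices comes from the arcs of [J'] and the size of
   [B]. *)
have ex : expands_over (arc_rel O) m B (fun=> d).
  move=> X leX; rewrite cst; split; first by apply: (implyP (exO X)).
  move=> geX; have := joined_nbh B jo geX.
  have : #|nbh (pair_rel J) B X| <= #|nbh (arc_rel O) B X|.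
    apply/subset_leq_card/subsetP => z /nbhP[zB [x xX xz]]; apply/nbhP; split=> //.
    by exists x; rewrite // /arc_rel (subsetP sJO) // inE /= zB.
  by move: leB leX; clear; nia.
pose out v := [set z | (v, z) \in O :\: J'].
have outP v : #|out v| <= d.
  have tz z : z \in out v -> exists2 X, tight (arc_rel O) m B (fun=> d) X &
      v \in X /\ z \notin nbh (arc_rel O) B (X :\ v).
    rewrite inE => vz; have [vzO vzJ] := setDP vz.
    have nP : ~~ P (O :\ (v, z)).
      apply/negP => /Omin /(_ (subsetDl _ _)) /setP /(_ (v, z)).
      by rewrite !inE eqxx vzO.
    move: nP; rewrite negb_and => /orP[/negP[]|].
      apply/subsetP => p pJ; rewrite !inE (subsetP sJO) // andbT.
      by apply: contraNneq vzJ => <-.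
    rewrite negb_forall => /existsP[X]; rewrite negb_imply -ltnNge => /andP[leX ltX].
    have zB : z \in B by have := subsetP sO _ vzO; rewrite inE => /andP[].
    have sub : nbh (arc_rel O) B X :\ z \subset nbh (arc_rel (O :\ (v, z))) B X.
      apply/subsetP => y; rewrite in_setD1 => /andP[yz /nbhP[yB [x xX xy]]].
      apply/nbhP; split=> //; exists x => //; rewrite /arc_rel !inE.
      by rewrite -/(arc_rel O x y) xy andbT xpair_eqE negb_and yz orbT.
    have le1 := subset_leq_card sub; have le2 := implyP (exO X) leX.
    have := cardsD1 z (nbh (arc_rel O) B X).
    have [zN|zN] := boolP (z \in nbh (arc_rel O) B X); last first.
      by move: le1 le2 ltX; clear; lia.
    move=> eqN.
    have zN' : z \notin nbh (arc_rel (O :\ (v, z))) B X.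
      apply/negP => zN'; suff : #|nbh (arc_rel O) B X| <= #|nbh (arc_rel (O :\ (v, z))) B X|.
        by move: le2 ltX; clear; lia.
      apply/subset_leq_card/subsetP => y yN; have [->//|yz] := eqVneq y z.
      by apply: (subsetP sub); rewrite in_setD1 yz.
    have onlyv x : x \in X -> (x, z) \in O -> x = v.
      move=> xX xz; apply/eqP/negPn/negP => xv; case/negP: zN'; apply/nbhP; split=> //.
      by exists x; rewrite // /arc_rel !inE xz xpair_eqE negb_and xv.
    have [x xX xz] := nbh_arc_rel zN; have xv := onlyv x xX xz.
    exists X; first by apply: tightP => //; rewrite cst; move: eqN le1 ltX; clear; lia.
    split; first by rewrite -xv.
    apply/negP => /nbh_arc_rel[y]; rewrite in_setD1 => /andP[yv yX] yz.
    by rewrite (onlyv y yX yz) eqxx in yv.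
  (* One tight set serves all arcs out of [v]: the tight sets of the single arcs share [v], and
     intersecting them keeps tightness. *)
  suff ind (s : seq V) : {subset s <= out v} -> s != [::] ->
      exists2 X, tight (arc_rel O) m B (fun=> d) X &
        v \in X /\ {in s, forall z, z \notin nbh (arc_rel O) B (X :\ v)}.
    have [->|] := eqVneq (out v) set0; first by rewrite cards0.
    case/set0Pn=> z0 z0P; have [||X tX [vX Xz]] := ind (enum (out v)).
    - by move=> z; rewrite mem_enum.
    - by rewrite -has_filter; apply/hasP; exists z0; rewrite // ?mem_enum.
    (* [X :\ v] has at least [d * (#|X| - 1)] neighbours, none in [out v], while [X] has exactly
       [d * #|X|]; this leaves at most [d] for [out v]. *)
    case/andP: tX => ltX /eqP; rewrite cst => eqX.
    have le1 : #|X :\ v| <= 2 * m by have := cardsD1 v X; move: ltX; clear; lia.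
    have := implyP (exO _) le1; have := cardsD1 v X; rewrite vX => cX le2.
    have : #|nbh (arc_rel O) B (X :\ v) :|: out v| <= #|nbh (arc_rel O) B X|.
      apply/subset_leq_card; rewrite subUset nbhS ?subsetDl //=.
      apply/subsetP => z zo; apply/nbhP; move: zo; rewrite inE => /setDP[vz _].
      split; first by have := subsetP sO _ vz; rewrite inE => /andP[].
      by exists v.
    rewrite cardsU (_ : _ :&: _ = set0) ?cards0; first by move: eqX le2 cX; clear; nia.
    apply/setP => z; rewrite in_setI in_set0; apply/negbTE/negP => /andP[zN zo].
    by have := Xz z; rewrite mem_enum zo => /(_ isT); rewrite zN.
  elim: s => // z s IH sz _; have [X tX [vX zX]] : exists2 X, tight (arc_rel O) m B (fun=> d) X &
      v \in X /\ z \notin nbh (arc_rel O) B (X :\ v) by apply: tz; apply: sz; rewrite mem_head.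
  have [s0|s0] := eqVneq s [::].
    by exists X => //; split=> // y; rewrite s0 inE => /eqP->.
  have [|Y tY [vY Yz]] := IH _ s0; first by move=> y ys; apply: sz; rewrite inE ys orbT.
  exists (X :&: Y); first by case: (tight_UI ex tX tY).
  split; first by rewrite inE vX.
  have sI y (Z : {set V}) : X :&: Y \subset Z -> y \notin nbh (arc_rel O) B (Z :\ v) ->
      y \notin nbh (arc_rel O) B ((X :&: Y) :\ v).
    by move=> sZ; apply: contra => /(subsetP (nbhS _ _ (setSD _ sZ))).
  move=> y; rewrite inE => /predU1P[->|/Yz]; first by apply: sI zX; apply: subsetIl.
  by apply: sI; apply: subsetIr.
have sub : O \subset J' :|: \bigcup_(v : V) [set (v, z) | z in out v].
  apply/subsetP => -[v z] vz; apply/setUP; have [?|nJ] := boolP ((v, z) \in J'); [by left|right].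
  by apply/bigcupP; exists v => //; apply: imset_f; rewrite inE in_setD nJ.
apply: leq_trans (subset_leq_card sub) _; apply: leq_trans (leq_card_setU _ _) _.
apply: leq_add cJ' _; apply: leq_trans (_ : \sum_(v : V) #|[set (v, z) | z in out v]| <= _).
  by apply: (big_ind2 (fun (X : {set V * V}) k => #|X| <= k)) => [|X x Y y lX lY|//];
    rewrite ?cards0 // (leq_trans (leq_card_setU _ _)) // leq_add.
apply: leq_trans (_ : \sum_(v : V) d <= _); last by rewrite sum_nat_const mulnC cardE.
by apply: leq_sum => v _; apply: leq_trans (leq_imset_card _ _) (outP v).
Qed.

End SparseExpander.

(** * Growing a tree along a bare path *)

Section Consecutive.

Variable V : finType.
Implicit Types (s : seq V) (u v : V).

Fixpoint succ_in s u v : bool :=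
  if s is a :: t then ((a == u) && (ohead t == Some v)) || succ_in t u v else false.

Definition adj_in s u v := succ_in s u v || succ_in s v u.

Lemma succ_in_cat s1 a s2 u v :
  succ_in (s1 ++ a :: s2) u v = succ_in (rcons s1 a) u v || succ_in (a :: s2) u v.
Proof.
elim: s1 => [|c s1 IH] /=; first by rewrite andbF.
by rewrite -/(succ_in (a :: s2) u v) IH !orbA; case: s1 {IH}.
Qed.

Lemma succ_in_rev s u v : succ_in (rev s) u v = succ_in s v u.
Proof.
elim: s => //= a s IH; rewrite rev_cons; case: s IH => [|c s] IH.
  by rewrite /= !andbF.
rewrite rev_cons -!cats1 -catA cat1s succ_in_cat -rev_cons IH orbC.
by rewrite /= !andbF !orbF andbC.
Qed.

Lemma succ_in_catP s u v :
  reflect (exists s1 s2, s = s1 ++ u :: v :: s2) (succ_in s u v).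
Proof.
elim: s => [|a s IH] /=; first by constructor=> -[[|? ?] [? ?]].
apply: (iffP orP) => [[/andP[/eqP-> ]|/IH[s1 [s2 ->]]]|].
- by case: s {IH} => //= c s /eqP[->]; exists [::], s.
- by exists (a :: s1), s2.
case=> -[|c s1] [s2 /= [-> def_s]]; first by left; rewrite def_s !eqxx.
by right; apply/IH; exists s1, s2.
Qed.

Lemma succ_in_mem s u v : succ_in s u v -> (u \in s) && (v \in s).
Proof. by case/succ_in_catP=> s1 [s2 ->]; rewrite !mem_cat !inE !eqxx !orbT. Qed.

Lemma succ_in_inj s u v v' : uniq s -> succ_in s u v -> succ_in s u v' -> v = v'.
Proof.
elim: s => //= a s IH /andP[as_ us] /orP[/andP[/eqP au hv]|uv] /orP[/andP[/eqP au' hv']|uv'].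
- by move: hv hv' => /eqP-> /eqP[].
- by rewrite au in as_; rewrite (andP (succ_in_mem uv')).1 in as_.
- by rewrite au' in as_; rewrite (andP (succ_in_mem uv)).1 in as_.
exact: IH.
Qed.

Lemma pred_in_inj s u u' v : uniq s -> succ_in s u v -> succ_in s u' v -> u = u'.
Proof.
move=> us; rewrite -!(succ_in_rev s); apply: succ_in_inj.
by rewrite rev_uniq.
Qed.

Lemma adj_in_sym s u v : adj_in s u v = adj_in s v u.
Proof. by rewrite /adj_in orbC. Qed.

Lemma adj_in_rev s u v : adj_in (rev s) u v = adj_in s u v.
Proof. by rewrite /adj_in !succ_in_rev orbC. Qed.

Lemma adj_in_cat s1 a s2 u v :
  adj_in (s1 ++ a :: s2) u v = adj_in (rcons s1 a) u v || adj_in (a :: s2) u v.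
Proof. by rewrite /adj_in !succ_in_cat orbACA. Qed.

Lemma adj_in_mem s u v : adj_in s u v -> (u \in s) && (v \in s).
Proof. by case/orP=> /succ_in_mem // /andP[-> ->]. Qed.

Lemma adj_in_card s u : uniq s -> #|[set v | adj_in s u v]| <= 2.
Proof.
move=> us; have -> : [set v | adj_in s u v] = [set v | succ_in s u v] :|: [set v | succ_in s v u].
  by apply/setP => v; rewrite !inE.
apply: leq_trans (leq_card_setU _ _) _; rewrite -[2]/(1 + 1); apply: leq_add.
  by apply/card_le1_eqP => v v'; rewrite !inE => h h'; apply: succ_in_inj h' h.
by apply/card_le1_eqP => v v'; rewrite !inE => h h'; apply: pred_in_inj h' h.
Qed.

Lemma succ_in_path (e : rel V) x p u v : path e x p -> succ_in (x :: p) u v -> e u v.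
Proof.
move=> ep /succ_in_catP[s1 [s2 def_p]]; move: ep.
case: s1 def_p => [|a s1] /= [-> ->] /=; first by case/andP.
by rewrite cat_path /= => /and4P[].
Qed.

Lemma interior_neighbours x p z : z \in behead (belast x p) ->
  exists a b, succ_in (x :: p) a z /\ succ_in (x :: p) z b.
Proof.
elim: p x => //= y p IH x; case: p IH => //= y' p IH.
rewrite inE => /predU1P[->|zp].
  by exists x, y'; rewrite !eqxx !orbT.
by have [a [b [ha hb]]] := IH y zp; exists a, b; rewrite ha hb !orbT.
Qed.

Lemma interior_sub (x : V) p : {subset behead (belast x p) <= x :: p}.
Proof. by move=> z /mem_behead /mem_belast. Qed.

Lemma interior_ends (x : V) p : uniq (x :: p) -> 0 < size p ->
  [set v in x :: p] :\: [set v in behead (belast x p)] = [set x; last x p].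
Proof.
move=> up p_gt0; set y := last x p; set J := behead _.
have defp : x :: p = x :: rcons J y.
  by rewrite /J /y; case: (p) p_gt0 => //= a q _; rewrite -lastI.
move: up; rewrite defp cons_uniq mem_rcons rcons_uniq inE negb_or.
case/andP=> /andP[_ xI] /andP[yI _]; apply/setP => v; rewrite !inE mem_rcons inE.
case: (eqVneq v x) => [->|_] /=; first by rewrite xI.
by case: (eqVneq v y) => [->|_] /=; rewrite ?yI // andNb.
Qed.

Lemma succ_in_map (h : V -> V) s u v :
  succ_in s u v -> succ_in (map h s) (h u) (h v).
Proof.
elim: s => //= a s IH /orP[/andP[/eqP-> hs]|/IH->]; last by rewrite orbT.
by rewrite eqxx; case: s {IH} hs => //= c s /eqP[->]; rewrite eqxx.
Qed.

Lemma succ_in_index s u v : uniq s -> succ_in s u v -> index v s = (index u s).+1.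
Proof.
move=> us /succ_in_catP[s1 [s2 def_s]]; move: us; rewrite def_s cat_uniq.
case/and3P=> _ hs /andP[+ _]; rewrite inE negb_or => /andP[uv _].
have us1 : u \notin s1 by apply: contra hs => h; rewrite /= h.
have vs1 : v \notin s1 by apply: contra hs => h; rewrite /= h orbT.
rewrite !index_cat (negbTE us1) (negbTE vs1) /= eqxx (negbTE uv) eqxx.
by rewrite addn0 addn1.
Qed.

(** The predecessor and the successor of an interior vertex are distinct, so they exhaust its degree
    2. *)
Lemma bare_path_adj (T : rel V) x p z u : symmetric T -> bare_path T x p ->
  z \in behead (belast x p) -> T z u -> adj_in (x :: p) z u.
Proof.
move=> Tsym [Tp up deg2] zI zu; have [a [b [az zb]]] := interior_neighbours zI.
have ab : a != b.
  apply/eqP => ab; rewrite ab in az.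
  by have := succ_in_index up az; have := succ_in_index up zb; lia.
have sub : [set a; b] \subset [set y | T z y].
  apply/subsetP => y; rewrite !inE => /orP[]/eqP->; last exact: succ_in_path Tp zb.
  by rewrite Tsym; apply: succ_in_path Tp az.
have /eqP eqN : [set a; b] == [set y | T z y].
  by rewrite eqEcard sub cards2 ab -/(degree T z) deg2.
have : u \in [set a; b] by rewrite eqN inE.
by rewrite !inE /adj_in => /orP[]/eqP->; rewrite ?zb ?az ?orbT.
Qed.

End Consecutive.

Section TreeGrowth.

Variables (V : finType) (T : rel V).

Definition induced (Z : {set V}) : rel V := fun u v => [&& T u v, u \in Z & v \in Z].

Definition induced_connected (Z : {set V}) : Prop :=
  {in Z &, forall u v, connect (induced Z) u v}.

Lemma induced_sym Z : symmetric T -> symmetric (induced Z).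
Proof. by move=> Tsym u v; rewrite /induced Tsym [(u \in Z) && _]andbC. Qed.

Lemma induced_connectedU1 Z z u : symmetric T -> induced_connected Z -> z \in Z -> T z u ->
  induced_connected (u |: Z).
Proof.
move=> Tsym conZ zZ zu.
have mono a b : connect (induced Z) a b -> connect (induced (u |: Z)) a b.
  apply: connect_sub => c d /and3P[cd cZ dZ]; apply: connect1.
  by rewrite /induced cd !inE cZ dZ !orbT.
have csym : connect_sym (induced (u |: Z)) by apply/sym_connect_sym/induced_sym.
have toz a : a \in u |: Z -> connect (induced (u |: Z)) z a.
  case/setU1P=> [->|aZ]; last by apply/mono/conZ.
  by apply: connect1; rewrite /induced zu !inE eqxx zZ orbT.
by move=> a b /toz za /toz zb; rewrite (connect_trans _ zb) // csym.
Qed.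

(** Two attachments of [u], linked by a path inside [Z], would close a cycle through [u]. *)
Lemma unique_attachment (Z : {set V}) u z z' : acyclic_graph T -> symmetric T ->
  induced_connected Z -> u \notin Z ->
  z \in Z -> z' \in Z -> T z u -> T z' u -> z = z'.
Proof.
move=> acy Tsym conZ uZ zZ z'Z zu z'u; apply/eqP/negPn/negP => zz'.
have /connectP[p0 p0P def_z'] := conZ z z' zZ z'Z.
case/shortenP: p0P def_z' => p pP up _ def_z'.
apply: (acy (u :: z :: p)); first by case: p {pP up} def_z' zz' => //= ->; rewrite eqxx.
have sub : {subset z :: p <= Z}.
  move: pP {up def_z'}; elim: p z {zu zz'} zZ => [|a p IH] z zZ /=.
    by move=> _ y; rewrite inE => /eqP->.
  case/andP=> /and3P[_ _ aZ] pP y; rewrite inE => /predU1P[->//|]; exact: IH pP y.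
have upath : path T z p by apply: sub_path pP => a b /and3P[].
apply/andP; split.
  by rewrite /= Tsym zu rcons_path upath -def_z' z'u.
by rewrite cons_uniq up andbT; apply: contra uZ => /sub.
Qed.

(** Without such an edge [Z] would be a union of connected components. *)
Lemma exists_attachment (Z : {set V}) : connected_graph T -> symmetric T ->
  Z != set0 -> Z != setT -> exists z u, [/\ z \in Z, u \notin Z & T z u].
Proof.
move=> [_ con] Tsym /set0Pn[z0 z0Z] ZT.
case: (boolP [exists z, exists u, [&& z \in Z, u \notin Z & T z u]]) => [|nex].
  by case/existsP=> z /existsP[u /and3P[? ? ?]]; exists z, u.
have clo : closed T Z.
  have half a b : T a b -> a \in Z -> b \in Z.
    move=> ab aZ; apply: contraR nex => bZ.
    by apply/existsP; exists a; apply/existsP; exists b; apply/and3P.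
  by move=> a b ab; apply/idP/idP; apply: half; rewrite // Tsym.
case/eqP: ZT; apply/setP => v; rewrite inE.
by rewrite -(closed_connect clo (con z0 v)).
Qed.

End TreeGrowth.

(** * Embedding a tree without the interior of its bare path *)

Section TreeEmbedding.

Variables (V : finType) (g T : rel V) (m D : nat) (A : {set V}) (x : V) (p : seq V).

Let I := [set z in behead (belast x p)].

Record partial_embedding (Z : {set V}) (f : V -> V) (w : V -> nat) : Prop := {
  pe_path : {subset x :: p <= Z};
  pe_connected : induced_connected T Z;
  pe_inj : {in Z :\: I &, injective f};
  pe_sub : {in Z :\: I, forall u, f u \in A};
  pe_hom : {in Z :\: I &, forall u v, T u v -> g (f u) (f v)};
  pe_cap : forall v, w v <= D;
  pe_fresh : forall v, v \notin f @: (Z :\: I) -> w v = D;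
  pe_demand : {in Z :\: I, forall z, #|[set u | T z u & u \notin Z]| <= w (f z)};
  pe_expands : forall X : {set V}, #|X| <= 2 * m ->
    \sum_(v in X) w v <= #|nbh g (A :\: f @: (Z :\: I)) X| }.

Hypotheses (treeT : is_tree T) (degT : forall v, degree T v <= D).
Hypotheses (bareT : bare_path T x p) (p_gt1 : 1 < size p).
Hypotheses (m_gt0 : 0 < m) (gsym : symmetric g) (jo : joined g m).
Hypothesis exA : forall X : {set V}, #|X| <= 2 * m -> (D + 2) * #|X| <= #|nbh g A X|.
Hypothesis bigA : #|V| + (2 * D + 3) * m <= #|A| + size p.

Lemma interior_card : #|I| = (size p).-1.
Proof.
have [_ up _] := bareT; rewrite cardsE (card_uniqP _) ?size_behead ?size_belast //.
apply: subseq_uniq up; rewrite lastI.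
apply: subseq_trans (subseq_rcons _ _); case: (belast x p) => //= a s; exact: subseq_cons.
Qed.

(** A tree vertex [u] adjacent to [Z] has a single neighbour [z] there, and [expands_over_leaf]
    supplies its image at the price of one unit of demand at [f z]. *)
Lemma grow_embedding Z f w : partial_embedding Z f w -> Z != setT ->
  exists Z' f' w', partial_embedding Z' f' w' /\ #|~: Z'| < #|~: Z|.
Proof.
have [[Tsym Tirr] con acy] := treeT.
move=> pe ZT; have [z [u [zZ uZ zu]]] : exists z u, [/\ z \in Z, u \notin Z & T z u].
  by apply: exists_attachment => //; apply/set0Pn; exists x; rewrite (pe_path pe) ?mem_head.
(* All neighbours of an interior vertex lie on the path, hence already in [Z]. *)
have zI : z \notin I.
  rewrite inE; apply/negP => /(bare_path_adj Tsym bareT) /(_ zu) /adj_in_mem /andP[_ /(pe_path pe)].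
  exact/negP.
have uI : u \notin I.
  by apply: contra uZ; rewrite inE => /interior_sub; apply: pe_path pe u.
have zZI : z \in Z :\: I by rewrite inE zI.
set S := f @: (Z :\: I).
have cS : #|S| + size p <= #|V|.
  have : #|(Z :\: I)| + #|I| < #|V|.
    have sub : I \subset Z.
      by apply/subsetP => v; rewrite inE => /interior_sub /(pe_path pe).
    have := cardsID I Z; rewrite (setIidPr sub) => eqZ.
    have : #|u |: Z| <= #|V| by rewrite max_card.
    by rewrite cardsU1 uZ; move: eqZ; clear; lia.
  have : #|S| <= #|Z :\: I| by apply: leq_imset_card.
  by rewrite interior_card; lia.
have ex : expands_over g m (A :\: S) w.
  move=> X leX; split; first exact: pe_expands pe X leX.
  move=> geX; have := joined_nbh (A :\: S) jo geX.
  have : \sum_(v in X) w v <= #|X| * D.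
    by rewrite -sum_nat_const; apply: leq_sum => v _; apply: pe_cap pe v.
  have : #|A| <= #|A :\: S| + #|S| by rewrite -(cardsID S A); have := subset_leq_card (subsetIr A S); lia.
  nia.
have wz : 0 < w (f z).
  apply: leq_trans (pe_demand pe zZI); apply/card_gt0P; exists u.
  by rewrite inE zu.
have [y yN exy] := expands_over_leaf m_gt0 ex wz.
have [/setDP[yA yS] zy] : y \in A :\: S /\ g (f z) y.
  by case/nbhP: yN => yA [a]; rewrite inE => /eqP->.
pose f' v := if v == u then y else f v.
have f'Z : {in Z, f' =1 f}.
  by move=> v vZ; rewrite /f'; case: eqP => // vu; rewrite -vu vZ in uZ.
have f'u : f' u = y by rewrite /f' eqxx.
pose w' v := w v - (v == f z).
have ZI : (u |: Z) :\: I = u |: (Z :\: I).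
  by apply/setP => v; rewrite in_setD !in_setU1 in_setD; case: eqP => //= ->; rewrite uI.
have S' : f' @: (u |: (Z :\: I)) = y |: S.
  rewrite imsetU1 /f' eqxx; congr (_ |: _).
  by apply: eq_in_imset => v /setDP[vZ _]; apply: f'Z.
have uniq_z v : v \in Z -> T v u -> v = z.
  by move=> vZ vu; apply: (unique_attachment acy Tsym (pe_connected pe) uZ).
exists (u |: Z), f', w'; split; last first.
  have := cardsC (u |: Z); have := cardsC Z; rewrite cardsU1 uZ; clear; lia.
split; rewrite ?ZI ?S'.
- by move=> v /(pe_path pe) vZ; rewrite inE vZ orbT.
- exact: induced_connectedU1 (pe_connected pe) zZ zu.
- move=> a c /setU1P[->|aZ] /setU1P[->|cZ] //.
  + rewrite f'u f'Z ?(subsetP (subsetDl Z I)) // => ya.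
    by rewrite ya imset_f in yS.
  + rewrite f'u f'Z ?(subsetP (subsetDl Z I)) // => ya.
    by rewrite -ya imset_f in yS.
  + by rewrite !f'Z ?(subsetP (subsetDl Z I)) //; apply: pe_inj pe a c aZ cZ.
- move=> a /setU1P[->|aZ]; first by rewrite f'u.
  by rewrite f'Z ?(subsetP (subsetDl Z I)) // (pe_sub pe).
- move=> a c /setU1P[->|aZ] /setU1P[->|cZ]; first by rewrite Tirr.
  + move=> uc; have cz : c = z by apply: uniq_z; rewrite 1?Tsym // (subsetP (subsetDl Z I)).
    by rewrite cz (f'Z z) // f'u gsym.
  + move=> au; have az : a = z by apply: uniq_z; rewrite // (subsetP (subsetDl Z I)).
    by rewrite az (f'Z z) // f'u.
  + by rewrite !f'Z ?(subsetP (subsetDl Z I)) //; apply: pe_hom pe a c aZ cZ.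
- by move=> v; apply: leq_trans (leq_subr _ _) (pe_cap pe v).
- move=> v; rewrite inE negb_or => /andP[_ vS]; rewrite /w' (pe_fresh pe vS).
  by case: eqP vS => [->|_ _]; rewrite ?subn0 // imset_f.
- move=> a /setU1P[->|aZ].
    have yz : y != f z by apply: contraNneq yS => ->; apply: imset_f.
    rewrite /w' f'u (negbTE yz) subn0 (pe_fresh pe yS).
    apply: leq_trans (degT u); apply/subset_leq_card/subsetP => v.
    by rewrite !inE => /andP[].
  have aZ' := subsetP (subsetDl Z I) _ aZ; rewrite f'Z // /w'.
  have [->|az] := eqVneq a z.
    rewrite eqxx; have := pe_demand pe zZI; rewrite (cardsD1 u) inE zu uZ /= add1n.
    set N := (X in X.+1 <= _) => h.
    suff : #|[set u0 | T z u0 & u0 \notin u |: Z]| <= N by move: h; clear; lia.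
    apply/subset_leq_card/subsetP => v.
    by rewrite !inE negb_or => /and3P[-> -> ->].
  have -> : (f a == f z) = false.
    by apply: contraNF az => /eqP /(pe_inj pe aZ zZI) ->.
  rewrite subn0; apply: leq_trans (pe_demand pe aZ); apply/subset_leq_card/subsetP => v.
  by rewrite !inE negb_or => /and3P[-> _ ->].
move=> X leX; have -> : A :\: (y |: S) = (A :\: S) :\ y by rewrite setDDl setUC.
exact: exy.
Qed.

Lemma embed_outside_bare_path : exists f : V -> V,
  [/\ {in ~: I &, injective f}, {in ~: I, forall u, f u \in A} &
      {in ~: I &, forall u v, T u v -> g (f u) (f v)}].
Proof.
have [[Tsym Tirr] con acy] := treeT; have [Tp up _] := bareT.
suff loop k Z f w : #|~: Z| < k -> partial_embedding Z f w ->
    exists f' w', partial_embedding setT f' w'.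
  suff [Z [f [w /(loop _ _ _ _ (leqnn _))[f' [w' pe]]]]] : exists Z f w, partial_embedding Z f w.
    by exists f'; rewrite -setTD; split; [apply: pe_inj pe|apply: pe_sub pe|apply: pe_hom pe].
  set y := last x p.
  have xy : x != y.
    apply: contraTneq up => xy; rewrite /= negb_and; apply/orP; left.
    by rewrite negbK xy /y; case: (p) p_gt1 => //= a q _; apply: mem_last.
  pose Z := [set v in x :: p].
  have ZI : Z :\: I = [set x; y] by apply: interior_ends => //; apply: ltnW.
  have cA : 1 < #|A|.
    have : size (x :: p) <= #|V| by rewrite -(card_uniqP up) max_card.
    have : 3 * m <= (2 * D + 3) * m by rewrite leq_mul2r leq_addl orbT.
    by move: bigA m_gt0 => /=; lia.
  have /card_gt1P[x' [y' [x'A y'A xy']]] := cA.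
  pose f v := if v == x then x' else y'.
  have fx : f x = x' by rewrite /f eqxx.
  have fy : f y = y' by rewrite /f eq_sym (negbTE xy).
  have fS : f @: [set x; y] = [set x'; y'] by rewrite imsetU1 imset_set1 fx fy.
  have nT : ~~ T x y.
    apply/negP => Txy; apply: (acy (x :: p)); first by rewrite /=; lia.
    by apply/andP; split=> //=; rewrite rcons_path Tp Tsym.
  exists Z, f, (fun=> D); split; rewrite ?ZI ?fS //.
  - by move=> v vp; rewrite inE.
  - have Zp : path (induced T Z) x p.
      have allZ : all (mem Z) (x :: p) by apply/allP => v vp; rewrite inE /= inE.
      apply: sub_in_path allZ Tp.
      by move=> a c aZ cZ ac; rewrite /induced ac aZ cZ.
    have toz a : a \in Z -> connect (induced T Z) x a.
      by rewrite inE => /(path_connect Zp).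
    move=> a c /toz xa /toz xc; apply: connect_trans xc.
    by rewrite (sym_connect_sym (induced_sym _ Tsym)).
  - move=> a c /set2P[]-> /set2P[]->; rewrite ?fx ?fy // => h; first by rewrite h eqxx in xy'.
    by rewrite h eqxx in xy'.
  - by move=> a /set2P[]->; rewrite ?fx ?fy.
  - move=> a c /set2P[]-> /set2P[]->; rewrite ?Tirr ?(negbTE nT) //.
    by rewrite Tsym (negbTE nT).
  - move=> a _; apply: leq_trans (degT a); apply/subset_leq_card/subsetP => v.
    by rewrite !inE => /andP[].
  (* The surplus 2 in the expansion factor [D + 2] pays for the two vertices taken out of [A]. *)
  move=> X leX; rewrite sum_nat_const.
  have := exA leX; have : #|nbh g A X| <= #|nbh g (A :\: [set x'; y']) X| + 2.
    rewrite -(cardsID [set x'; y']) addnC; apply: leq_add; last first.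
      by apply: leq_trans (subset_leq_card (subsetIr _ _)) _; rewrite cards2; case: (_ != _).
    apply/subset_leq_card/subsetP => v /setDP[/nbhP[vA vX] vn].
    by apply/nbhP; rewrite in_setD vn.
  have [->|] := eqVneq X set0; first by rewrite cards0 mul0n.
  rewrite -card_gt0; nia.
elim: k Z f w => // k IH Z f w; rewrite ltnS => leZ pe.
have [defZ|ZT] := eqVneq Z setT; first by exists f, w; rewrite -defZ.
have [Z' [f' [w' [pe' lt]]]] := grow_embedding pe ZT.
exact: IH (leq_trans lt leZ) pe'.
Qed.

End TreeEmbedding.

(** * Rotations with a protected pair *)

Section Routes.

Variable V : finType.
Implicit Types (s : seq V) (u v a c : V).

Definition same_pair a c u v := ((u == a) && (v == c)) || ((u == c) && (v == a)).

Lemma adj_in_cons2 a c s u v :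
  adj_in (a :: c :: s) u v = same_pair a c u v || adj_in (c :: s) u v.
Proof.
have E x y : (Some x == Some y) = (x == y) by [].
rewrite /adj_in /same_pair /= -!/(succ_in (c :: s) _ _) !E.
rewrite ![a == _]eq_sym ![c == _]eq_sym [(v == a) && _]andbC.
by rewrite orbACA.
Qed.

Lemma adj_in_rcons2 s a c u v :
  adj_in (rcons (rcons s a) c) u v = same_pair a c u v || adj_in (rcons s a) u v.
Proof.
rewrite -adj_in_rev !rev_rcons adj_in_cons2 -rev_rcons adj_in_rev.
by rewrite /same_pair [(_ && _) || _ in LHS]orbC.
Qed.

Lemma adj_in_join a s c s' u v :
  adj_in ((a :: s) ++ c :: s') u v =
  [|| adj_in (a :: s) u v, same_pair (last a s) c u v | adj_in (c :: s') u v].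
Proof.
rewrite adj_in_cat lastI adj_in_rcons2 -orbA.
by rewrite orbCA.
Qed.

Section Rotation.

Variables (W : {set V}) (x y : V).

(** A path in [W] that traverses the extra edge [xy]. Once a spanning route closes to a cycle,
    deleting [xy] leaves a spanning path from [x] to [y]. *)
Record route (e : rel V) (s : seq V) : Prop := {
  route_uniq : uniq s;
  route_sub : {subset s <= W};
  route_adj : forall u v, adj_in s u v -> e u v || same_pair x y u v;
  route_xy : adj_in s x y }.

Definition longest_route e s := route e s /\ forall s', route e s' -> size s' <= size s.

Lemma same_pair_sym a c u v : same_pair a c u v = same_pair u v a c.
Proof. by rewrite /same_pair ![a == _]eq_sym ![c == _]eq_sym [(v == a) && _]andbC. Qed.

Lemma route_mem e s : route e s -> (x \in s) && (y \in s).
Proof. by move/route_xy/adj_in_mem. Qed.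

Lemma route_rev e s : route e s -> route e (rev s).
Proof.
case=> us sW se sxy; split; rewrite ?rev_uniq ?adj_in_rev //.
  by move=> v; rewrite mem_rev => /sW.
by move=> u v; rewrite adj_in_rev => /se.
Qed.

Lemma head_rev s a : head a (rev s) = last a s.
Proof. by case: s => //= c s; rewrite lastI rev_rcons. Qed.

Lemma last_rev s a : last a (rev s) = head a s.
Proof. by rewrite -[s in RHS]revK head_rev. Qed.

Lemma longest_rev e s : longest_route e s -> longest_route e (rev s).
Proof. by case=> /route_rev rs mx; split=> // s' /mx; rewrite size_rev. Qed.

Lemma adj_in_pivot s1 w u s2 a c :
  adj_in (s1 ++ w :: u :: s2) a c =
  [|| adj_in (rcons s1 w) a c, same_pair w u a c | adj_in (u :: s2) a c].
Proof. by rewrite adj_in_cat adj_in_cons2. Qed.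

Lemma adj_in_rotated s1 w u s2 a c :
  adj_in (s1 ++ w :: rev (u :: s2)) a c =
  [|| adj_in (rcons s1 w) a c, same_pair w (last u s2) a c | adj_in (u :: s2) a c].
Proof.
rewrite adj_in_cat -[in RHS](adj_in_rev (u :: s2)) (lastI u s2) rev_rcons.
by rewrite adj_in_cons2.
Qed.

Lemma route_rotate e s1 w u s2 : symmetric e -> route e (s1 ++ w :: u :: s2) ->
  e (last u s2) w -> ~~ same_pair x y w u -> route e (s1 ++ w :: rev (u :: s2)).
Proof.
move=> esym [us sW se sxy] lw nwu.
have pe : perm_eq (s1 ++ w :: rev (u :: s2)) (s1 ++ w :: u :: s2).
  by rewrite perm_cat2l perm_cons perm_rev.
split.
- by rewrite (perm_uniq pe).
- by move=> v; rewrite (perm_mem pe) => /sW.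
- move=> a c; rewrite adj_in_rotated => /or3P[h|h|h].
  + by apply: se; rewrite adj_in_pivot h.
  + by case/orP: h => /andP[/eqP-> /eqP->]; rewrite ?lw // esym lw.
  + by apply: se; rewrite adj_in_pivot h !orbT.
- move: sxy; rewrite adj_in_pivot adj_in_rotated => /or3P[->//|h|->]; last by rewrite !orbT.
  by rewrite same_pair_sym h in nwu.
Qed.

Variable e : rel V.

(** Posa rotations with a fixed first vertex: the edge from the last vertex to [w] replaces the pair
    [wu], which must not be the protected pair [xy]. *)
Inductive rotation (s0 : seq V) : seq V -> Prop :=
| rotation_refl : rotation s0 s0
| rotation_step s1 w u s2 : rotation s0 (s1 ++ w :: u :: s2) ->
    e (last u s2) w -> ~~ same_pair x y w u ->
    rotation s0 (s1 ++ w :: rev (u :: s2)).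

Hypotheses (esym : symmetric e) (eW : forall u v, e u v -> v \in W).

Lemma rotation_route s0 s : route e s0 -> rotation s0 s ->
  [/\ route e s, perm_eq s s0 & head x s = head x s0].
Proof.
move=> r0; elim=> // s1 w u s2 _ [rs szs hs] lw nwu; split.
- exact: route_rotate.
- by apply: perm_trans szs; rewrite perm_cat2l perm_cons perm_rev.
- by rewrite -hs; case: s1 {rs szs hs}.
Qed.

Definition rotation_ends s0 : {set V} :=
  [set r | `[< exists2 s, rotation s0 s & last x s = r >]].

Lemma rotation_endsP s0 r :
  reflect (exists2 s, rotation s0 s & last x s = r) (r \in rotation_ends s0).
Proof. by rewrite inE; apply: asboolP. Qed.

(** Every pair cut by a rotation contains the end that this rotation creates. *)
Lemma rotation_preserves s0 s a c : rotation s0 s -> adj_in s0 a c ->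
  a \notin rotation_ends s0 -> c \notin rotation_ends s0 -> adj_in s a c.
Proof.
move=> rot ac aR cR; elim: rot => // s1 w u s2 rot IH lw nwu.
have uR : u \in rotation_ends s0.
  apply/rotation_endsP; exists (s1 ++ w :: rev (u :: s2)); first exact: rotation_step.
  by rewrite last_cat /= last_rev.
move: IH; rewrite adj_in_pivot adj_in_rotated => /or3P[->//|h|->]; last by rewrite !orbT.
by case/orP: h => /andP[/eqP ha /eqP hc]; [rewrite hc uR in cR | rewrite ha uR in aR].
Qed.

(* Posa's lemma: a vertex of the longest path adjacent to an end keeps its path
   neighbours unless one of them is an end itself.  The exceptions [x], [y] come
   from the pair that may not be cut, the third one is the fixed end. *)
Lemma posa s0 : longest_route e s0 ->
  #|nbh e (~: rotation_ends s0) (rotation_ends s0)| <= 2 * #|rotation_ends s0| + 3.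
Proof.
move=> [r0 mx]; set R := rotation_ends s0.
pose N := \bigcup_(r in R) [set w | adj_in s0 r w].
suff sub : nbh e (~: R) R \subset N :|: [set x; y] :|: [set head x s0].
  apply: leq_trans (subset_leq_card sub) _; apply: leq_trans (leq_card_setU _ _) _.
  have [h _] := leq_card_setU N [set x; y]; rewrite cards2 in h; rewrite cards1.
  have : #|N| <= 2 * #|R|.
    apply: leq_trans (_ : \sum_(r in R) #|[set w | adj_in s0 r w]| <= _).
      by apply: (big_ind2 (fun (X : {set V}) k => #|X| <= k)) => [|X a Y c lX lY|//];
        rewrite ?cards0 // (leq_trans (leq_card_setU _ _)) // leq_add.
    rewrite mulnC -sum_nat_const; apply: leq_sum => r _.
    exact: adj_in_card (route_uniq r0).
  by case: (x != y) h => /=; lia.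
apply/subsetP => w /nbhP[]; rewrite inE => wR [r /rotation_endsP[s rot def_r] rw].
have [rs pes hs] := rotation_route r0 rot; have us := route_uniq rs.
(* Otherwise [w] could be appended to a longest route. *)
have ws : w \in s.
  apply/negPn/negP => ws; suff /mx : route e (rcons s w).
    by rewrite size_rcons (perm_size pes) ltnn.
  have [xs _] := andP (route_mem rs).
  case/lastP: s rs us ws def_r xs {rot hs pes} => // s l rs us ws.
  rewrite last_rcons => def_l _; rewrite def_l in rs us ws *; split.
  - by rewrite rcons_uniq ws.
  - move=> v; rewrite mem_rcons inE => /predU1P[->|]; first exact: eW rw.
    exact: route_sub rs v.
  - move=> u v; rewrite adj_in_rcons2 => /orP[|]; last exact: route_adj rs u v.
    by case/orP=> /andP[/eqP-> /eqP->]; rewrite ?rw // esym rw.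
  - by rewrite adj_in_rcons2 (route_xy rs) orbT.
have ws0 : w \in s0 by rewrite -(perm_mem pes).
rewrite !in_setU !in_set1; apply: contraR wR.
rewrite !negb_or => /andP[/andP[wN /andP[wx wy]] wh].
have rR : r \in R by apply/rotation_endsP; exists s.
case/splitPr: ws rot def_r us rs pes hs => s1 [|u s2] rot def_r us rs pes hs.
  by rewrite last_cat /= in def_r; rewrite def_r.
have nwu : ~~ same_pair x y w u by rewrite /same_pair (negbTE wx) (negbTE wy).
have uR : u \in R.
  apply/rotation_endsP; exists (s1 ++ w :: rev (u :: s2)).
    by apply: rotation_step => //; rewrite last_cat /= in def_r; rewrite def_r.
  by rewrite last_cat /= last_rev.
apply/negPn/negP => wR.
have l0 : last x s0 \in R by apply/rotation_endsP; exists s0 => //; constructor.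
have u0 := route_uniq r0.
have notR a : adj_in s0 w a -> a \notin R.
  move=> wa; apply: contra wN => aR; apply/bigcupP; exists a => //.
  by rewrite inE adj_in_sym.
have pres a : adj_in s0 w a -> adj_in (s1 ++ w :: u :: s2) w a.
  by move=> wa; apply: rotation_preserves rot wa wR (notR a wa).
(* As [w] is neither the first nor the last vertex of [s0], it has two neighbours there. They are
   not ends, so both are still its neighbours in [s], besides the end [u]: three neighbours on one
   path. *)
have [a [c [ac wa wc]]] : exists a c, [/\ a != c, adj_in s0 w a & adj_in s0 w c].
  case/splitPr: ws0 l0 wh u0 {notR pres} => t1 t2.
  case/lastP: t1 => [|t1 a] /=; first by rewrite eqxx.
  case: t2 => [|c t2]; first by rewrite last_cat /= (negbTE wR).
  move=> _ _; rewrite cat_uniq => /and3P[_ + _] => hs0; exists a, c; split.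
  - apply: contraNneq hs0 => <-; apply/hasP; exists a; rewrite /= ?inE ?eqxx ?orbT //.
    by rewrite mem_rcons inE eqxx.
  - rewrite adj_in_sym -cats1 -catA cat1s adj_in_cat; apply/orP; right.
    by rewrite adj_in_cons2 /same_pair !eqxx.
  - rewrite adj_in_cat; apply/orP; right.
    by rewrite adj_in_cons2 /same_pair !eqxx.
have := adj_in_card w us; apply/negP; rewrite -ltnNge.
apply/card_gt2P; exists a, c, u; rewrite !inE (pres a wa) (pres c wc); split.
  by split=> //; rewrite adj_in_pivot /same_pair !eqxx orbT.
split=> //; last by apply: contraNneq (notR a wa) => <-.
by apply: contraNneq (notR c wc) => ->.
Qed.

Lemma many_rotation_ends m s0 : longest_route e s0 ->
  (forall X : {set V}, X \subset W -> 0 < #|X| <= m -> 2 * #|X| + 3 < #|nbh e (~: X) X|) ->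
  m < #|rotation_ends s0|.
Proof.
move=> lr0 ex; have [r0 _] := lr0; rewrite ltnNge; apply/negP => le.
have : 2 * #|rotation_ends s0| + 3 < #|nbh e (~: rotation_ends s0) (rotation_ends s0)|.
  apply: ex; last first.
    rewrite le andbT; apply/card_gt0P; exists (last x s0).
    by apply/rotation_endsP; exists s0 => //; constructor.
  apply/subsetP => r /rotation_endsP[s /(rotation_route r0)[rs _ _] <-].
  have [xs _] := andP (route_mem rs); apply: (route_sub rs).
  by case: (s) xs => //= a s' _; apply: mem_last.
by apply/negP; rewrite -leqNgt; apply: posa.
Qed.

Definition boosters : {set {set V}} :=
  [set E | `[< exists s, longest_route e s /\ E = [set head x s; last x s] >]].

Lemma pairs_card (P : {set V * V}) : #|P| <= 2 * #|[set [set p.1; p.2] | p in P]|.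
Proof.
rewrite -sum1_card (partition_big_imset (fun p => [set p.1; p.2])) /= mulnC -sum_nat_const.
apply: leq_sum => E /imsetP[[a c] _ ->] /=.
rewrite sum1_card; apply: leq_trans (_ : #|[set (a, c); (c, a)]| <= _); last first.
  by rewrite cards2; case: (_ != _).
apply/subset_leq_card/subsetP => -[u v]; rewrite unfold_in /= => /andP[_ /eqP /setP eqE].
have := eqE u; have := eqE v; have := eqE a; have := eqE c; rewrite !inE !eqxx !xpair_eqE !orbT /=.
rewrite ![a == _]eq_sym ![c == _]eq_sym.
by case: (u == a) (u == c) (v == a) (v == c) => [] [] [] [].
Qed.

(** Each of the more than [m] ends serves in turn as the fixed vertex of a second family of
    rotations, with more than [m] ends again; the factor 2 forgets the order of the two ends. *)
Lemma many_boosters m s0 : longest_route e s0 ->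
  (forall X : {set V}, X \subset W -> 0 < #|X| <= m -> 2 * #|X| + 3 < #|nbh e (~: X) X|) ->
  m * m <= 2 * #|boosters|.
Proof.
move=> lr0 ex; have [r0 mx0] := lr0.
have longest s s' : longest_route e s -> rotation s s' -> longest_route e s'.
  move=> [rs mx] rot; have [rs' pe _] := rotation_route rs rot.
  by split=> // t /mx; rewrite (perm_size pe).
(* Reversal turns an end [r] into the first vertex; the value [s0] for other [r] is a dummy. *)
have /choice[F FP] r : exists s, r \in rotation_ends s0 -> longest_route e s /\ head x s = r.
  have [/rotation_endsP[s rot <-]|_] := boolP (r \in _); last by exists s0.
  by exists (rev s) => _; split; [apply/longest_rev/(longest _ _ lr0 rot)|rewrite head_rev].
pose P := [set p : V * V | (p.1 \in rotation_ends s0) && (p.2 \in rotation_ends (F p.1))].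
have leP : m * m <= #|P|.
  have -> : #|P| = \sum_(r in rotation_ends s0) #|rotation_ends (F r)|.
    rewrite -sum1_card.
    rewrite (eq_bigr (fun r => \sum_(t in rotation_ends (F r)) 1)); last by move=> r _; rewrite sum1_card.
    rewrite pair_big_dep /=; apply: eq_bigl => -[r t]; rewrite inE //.
  apply: leq_trans (_ : \sum_(r in rotation_ends s0) m <= _).
    by rewrite sum_nat_const leq_mul2r ltnW ?orbT // many_rotation_ends.
  by apply: leq_sum => r /FP[lr _]; apply/ltnW/many_rotation_ends.
apply: leq_trans leP _; apply: leq_trans (pairs_card P) _; rewrite leq_mul2l /=.
apply/subset_leq_card/subsetP => E /imsetP[[r t]]; rewrite !inE /= => /andP[rR tR] ->.
have [lr hr] : longest_route e (F r) /\ head x (F r) = r by apply: FP; rewrite inE.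
have /rotation_endsP[s rot <-] : t \in rotation_ends (F r) by rewrite inE.
apply/asboolP; exists s; split; first exact: longest lr rot.
by case: lr => rF _; have [_ _ ->] := rotation_route rF rot; rewrite hr.
Qed.

End Rotation.

(** * Closing a route and extending it *)

Section Extension.

Variables (W : {set V}) (x y : V) (e e' : rel V).
Hypotheses (neq_xy : x != y) (e'sym : symmetric e') (ee' : forall u v, e u v -> e' u v).

Lemma route_mono s : route W x y e s -> route W x y e' s.
Proof.
by case=> us sW se sxy; split=> // u v /se /orP[/ee'->//|->]; rewrite orbT.
Qed.

(** The cycle obtained by joining the two ends is opened just before [c], which becomes an end next
    to [q]. The last hypothesis keeps [xy] uncut. *)
Lemma route_extend_cut s1 c s2 q : route W x y e (s1 ++ c :: s2) ->
  e' (last c s2) (head c s1) -> e' c q -> q \in W -> q \notin s1 ++ c :: s2 ->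
  (s1 == [::]) || ~~ same_pair x y (last c s1) c ->
  route W x y e' (q :: c :: s2 ++ s1).
Proof.
move=> /route_mono [us sW se sxy] rt cq qW qs cut.
have pe : perm_eq (q :: c :: s2 ++ s1) (q :: s1 ++ c :: s2).
  by rewrite perm_cons -cat_cons perm_catC.
have adjE u v : adj_in (q :: c :: s2 ++ s1) u v -> [|| same_pair q c u v,
    same_pair (last c s2) (head c s1) u v | adj_in (s1 ++ c :: s2) u v].
  rewrite adj_in_cons2 => /orP[->//|]; case: (s1) => [|b s1'].
    by rewrite cats0 => ->; rewrite !orbT.
  rewrite -cat_cons !adj_in_join => /or3P[->|->|->]; rewrite ?orbT //.
split.
- by rewrite (perm_uniq pe) /= qs.
- by move=> v; rewrite (perm_mem pe) inE => /predU1P[->|/sW].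
- move=> u v /adjE /or3P[h|h|/se//].
    by case/orP: h => /andP[/eqP-> /eqP->]; rewrite ?cq // e'sym cq.
  by case/orP: h => /andP[/eqP-> /eqP->]; rewrite ?rt // e'sym rt.
- rewrite adj_in_cons2; apply/orP; right; move: sxy cut; case: (s1) => [|b s1'] /=.
    by rewrite cats0.
  rewrite -!cat_cons !adj_in_join => /or3P[->|h|->]; rewrite ?orbT //.
  by rewrite same_pair_sym h.
Qed.

Lemma route_extend s c q : route W x y e s -> e' (last x s) (head x s) ->
  c \in s -> e' c q -> q \in W -> q \notin s ->
  exists2 s', route W x y e' s' & size s' = (size s).+1.
Proof.
move=> rs rt cs cq qW qs; case/splitPr: cs rs rt qs => s1 s2 rs rt qs.
have sz : size (q :: c :: s2 ++ s1) = (size (s1 ++ c :: s2)).+1.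
  by rewrite /= !size_cat /= addnC addnS.
have rt1 : e' (last c s2) (head c s1).
  by move: rt; rewrite last_cat; case: (s1).
case: (boolP ((s1 == [::]) || ~~ same_pair x y (last c s1) c)) => [cut|].
  by exists (q :: c :: s2 ++ s1) => //; apply: route_extend_cut.
(* Here [xy] is the pair just before [c], so the reversed route is used to open the cycle just after
   [c]. Both pairs at [c] cannot be [xy], as the vertices of a route are distinct. *)
rewrite negb_or negbK => /andP[s1n sp1].
exists (q :: c :: rev s1 ++ rev s2).
  apply: route_extend_cut => //; rewrite ?last_rev ?head_rev.
  - by have := route_rev rs; rewrite rev_cat rev_cons cat_rcons.
  - by rewrite e'sym.
  - by rewrite -cat_rcons -rev_cons -rev_cat mem_rev.
  case: s2 rs {rt qs sz rt1} => [|b s2] rs; first by [].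
  apply/orP; right; apply/negP => sp2.
  have eqb : b = last c s1.
    move: sp1 sp2; rewrite /same_pair /=.
    case/orP=> /andP[/eqP-> /eqP->] /orP[]/andP[/eqP-> ]; rewrite ?eqxx // ?(negbTE neq_xy) //.
    by rewrite eq_sym (negbTE neq_xy).
  have := route_uniq rs; rewrite cat_uniq => /and3P[_ /hasP[]].
  exists b; first by rewrite !inE eqxx orbT.
  by rewrite /= eqb; case: (s1) s1n => //= a t _; apply: mem_last.
by rewrite /= !size_cat !size_rev /= -addnS.
Qed.

Lemma route_close (g : rel V) s : symmetric g -> (forall u v, e u v -> g u v) ->
  route W x y e s -> g (last x s) (head x s) -> exists h,
  [/\ perm_eq (x :: h) s, last x h = y & forall u v, succ_in (x :: h) u v -> g u v].
Proof.
(* With [y] just before [x], the path runs from [x] to the end of [s], over the closing edge to its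
   beginning, and on to [y]. *)
move=> gsym eg rs rt; wlog : s rs rt / succ_in s y x.
  move=> H; case/orP: (route_xy rs) => sxy; last exact: H rs rt sxy.
  have [||h [ph lh sh]] := H (rev s) (route_rev rs).
  - by rewrite last_rev head_rev gsym.
  - by rewrite succ_in_rev.
  by exists h; split=> //; apply: perm_trans ph _; rewrite perm_rev.
case/succ_in_catP=> s1 [s2 def_s]; rewrite def_s in rs rt *.
exists (s2 ++ rcons s1 y); split.
- by rewrite -cat_cons perm_catC cat_rcons.
- by rewrite last_cat last_rcons.
move=> u v suv.
have us := route_uniq rs.
have okadj a c : adj_in (s1 ++ y :: x :: s2) a c -> (x \notin [:: a; c]) || (y \notin [:: a; c]) -> g a c.
  move=> /(route_adj rs) /orP[/eg//|]; rewrite /same_pair.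
  by case/orP=> /andP[/eqP-> /eqP->]; rewrite !inE !eqxx !orbT.
have : adj_in ((x :: s2) ++ rcons s1 y) u v by rewrite /adj_in suv.
rewrite headI adj_in_join -headI => /or3P[h|h|h].
- apply: okadj; first by rewrite adj_in_pivot h !orbT.
  have [ui vi] := andP (adj_in_mem h); apply/orP; right; rewrite !inE negb_or.
  have ny : y \notin x :: s2 by move: us; rewrite cat_uniq => /and3P[_ _ /= /andP[]].
  by apply/andP; split; apply: contraNneq ny => ->.
- have rt' : g (last x s2) (head y s1) by move: rt; rewrite last_cat /=; case: (s1).
  by case/orP: h => /andP[/eqP-> /eqP->]; rewrite ?rt' // gsym rt'.
- apply: okadj; first by rewrite adj_in_pivot h.
  have [ui vi] := andP (adj_in_mem h); apply/orP; left; rewrite !inE negb_or.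
  have nx : x \notin rcons s1 y.
    move: us; rewrite -cat_rcons cat_uniq => /and3P[_ + _]; apply: contra => xs.
    by rewrite /= xs.
  by apply/andP; split; apply: contraNneq nx => ->.
Qed.

End Extension.

Definition host (W : {set V}) (O : {set V * V}) : rel V :=
  fun u v => [&& pair_rel O u v, u \in W & v \in W].

Lemma host_sym W O : symmetric (host W O).
Proof. by move=> u v; rewrite /host /pair_rel orbC [(u \in W) && _]andbC. Qed.

Lemma host_mono W (O O' : {set V * V}) u v : O \subset O' -> host W O u v -> host W O' u v.
Proof.
by move=> sO /and3P[/orP[] /(subsetP sO) h uW vW]; rewrite /host /pair_rel h ?orbT uW vW.
Qed.

Lemma set2_eq (r t a c : V) : [set r; t] = [set a; c] ->
  (r = a /\ t = c) \/ (r = c /\ t = a).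
Proof.
move=> eqs; have rs : r \in [set a; c] by rewrite -eqs set21.
have ts : t \in [set a; c] by rewrite -eqs set22.
have as_ : a \in [set r; t] by rewrite eqs set21.
have cs : c \in [set r; t] by rewrite eqs set22.
case/set2P: rs as_ cs => ->; case/set2P: ts => ->; auto.
  by move=> _ /set2P[]->; left.
by move=> /set2P[]-> _; left.
Qed.

Lemma hamiltonian_path (g : rel V) (W : {set V}) (x y : V) (m k0 : nat) (O0 : {set V * V}) :
  symmetric g -> joined g m -> x != y -> x \in W -> y \in W ->
  #|O0| <= k0 -> (forall u v, (u, v) \in O0 -> g u v) ->
  (forall X : {set V}, X \subset W -> 0 < #|X| <= m ->
     2 * #|X| + 3 < #|nbh (host W O0) (~: X) X|) ->
  (forall O : {set V * V}, #|O| <= k0 + 2 * #|V| ->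
     m * m <= 2 * #|boosters W x y (host W O)| ->
     exists r t, g r t /\ [set r; t] \in boosters W x y (host W O)) ->
  exists h, [/\ uniq (x :: h), x :: h =i W, last x h = y &
                forall u v, succ_in (x :: h) u v -> g u v].
Proof.
move=> gsym jo xy xW yW leO0 O0g ex hit.
(* Each round adds two arcs to [O] and at least one vertex to the route, hence the budget
   [k0 + 2 * size s]. *)
suff loop k (O : {set V * V}) s : #|W| - size s < k -> O0 \subset O -> (forall u v, (u, v) \in O -> g u v) ->
    #|O| <= k0 + 2 * size s -> route W x y (host W O) s ->
    exists h, [/\ uniq (x :: h), x :: h =i W, last x h = y &
                  forall u v, succ_in (x :: h) u v -> g u v].
  apply: (loop _ O0 [:: x; y] (leqnn _)) => //; first by apply: leq_trans leO0 (leq_addr _ _).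
  split=> [|v|u v|].
  - by rewrite /= inE xy.
  - by rewrite !inE => /orP[]/eqP->.
  - rewrite adj_in_cons2 /adj_in /= !andbF !orbF => ->; exact: orbT.
  - by rewrite adj_in_cons2 /same_pair !eqxx.
elim: k O s => // k IH O s ltk sO Og leO rs.
have leW s' : route W x y (host W O) s' -> size s' <= #|W|.
  case=> us' sW' _ _; rewrite cardE; apply: uniq_leq_size us' _ => v /sW'.
  by rewrite mem_enum.
have WV : #|W| <= #|V| by apply: max_card.
have [s' lr] : exists s', longest_route W x y (host W O) s'.
  pose Q l := `[< exists2 t, route W x y (host W O) t & size t = l >].
  have exQ : exists l, Q l by exists (size s); apply/asboolP; exists s.
  have ubQ l : Q l -> l <= #|W| by move/asboolP=> [t /leW + <-].
  case: (ex_maxnP exQ ubQ) => l /asboolP[t rt szt] mx; exists t; split=> // t' rt'.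
  by rewrite szt; apply: mx; apply/asboolP; exists t'.
have exO (X : {set V}) : X \subset W -> 0 < #|X| <= m -> 2 * #|X| + 3 < #|nbh (host W O) (~: X) X|.
  move=> XW Xm; apply: leq_trans (ex X XW Xm) _; apply/subset_leq_card/subsetP => z.
  by case/nbhP=> zX [v vX vz]; apply/nbhP; split=> //; exists v => //; apply: host_mono vz.
have hostW u v : host W O u v -> v \in W by case/and3P.
have hostg u v : host W O u v -> g u v.
  by case/and3P=> /orP[/Og//|/Og]; rewrite gsym.
have mb := many_boosters (@host_sym W O) hostW lr exO.
have leO2 : #|O| <= k0 + 2 * #|V| by have := leW _ rs; move: leO WV; clear; lia.
have [r [t [grt]]] := hit O leO2 mb; rewrite inE => /asboolP[z [lz eqz]].
have gz : g (last x z) (head x z).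
  by case: (set2_eq eqz) => -[<- <-]; rewrite // gsym.
have [rz mz] := lz.
have [S SE] : exists S : {set V}, S =i z by exists [set v in z] => v; rewrite inE.
have cS : #|S| = size z by rewrite (eq_card SE); apply/card_uniqP/(route_uniq rz).
have SW : S \subset W by apply/subsetP => v; rewrite SE; apply: (route_sub rz).
have [eqS|neS] := eqVneq S W.
  have [h [ph lh sh]] := route_close gsym hostg rz gz.
  exists h; split=> //; first by rewrite (perm_uniq ph) (route_uniq rz).
  by move=> v; rewrite (perm_mem ph) -SE eqS.
(* An edge leaves the cycle: by expansion of [O0] if the covered or the uncovered part of [W] has at
   most [m] vertices, and by joinedness if both are larger. *)
have [c [q [cz qW qz gcq]]] : exists c q, [/\ c \in z, q \in W, q \notin z & g c q].
  have Q0 : 0 < #|W :\: S|.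
    by rewrite card_gt0 setD_eq0; apply: contra neS => WS; rewrite eqEsubset SW.
  have S0 : 0 < #|S|.
    by apply/card_gt0P; exists x; rewrite SE; case/andP: (route_mem rz).
  have [leQ|ltQ] := leqP #|W :\: S| m.
    have : 0 < #|nbh (host W O0) (~: (W :\: S)) (W :\: S)|.
      by apply: leq_trans (ex _ (subsetDl _ _) _); rewrite ?Q0.
    case/card_gt0P=> c /nbhP[]; rewrite in_setC in_setD => + [q /setDP[qW qS] /and3P[qc _ cW]].
    rewrite cW andbT negbK SE => cz; exists c, q; split=> //; first by rewrite -SE.
    by case/orP: qc => /O0g //; rewrite gsym.
  have [leS|ltS] := leqP #|S| m.
    have : 0 < #|nbh (host W O0) (~: S) S|.
      by apply: leq_trans (ex _ SW _); rewrite ?S0.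
    case/card_gt0P=> q /nbhP[]; rewrite in_setC => qS [c cS' /and3P[cq _ qW]].
    exists c, q; rewrite -!SE; split=> //.
    by case/orP: cq => /O0g //; rewrite gsym.
  have [S1 sS1 cS1] := subset_of_card (ltnW ltS).
  have [Q1 sQ1 cQ1] := subset_of_card (ltnW ltQ).
  have dis : [disjoint S1 & Q1].
    rewrite disjoints_subset; apply/subsetP => v /(subsetP sS1) vS; rewrite inE.
    by apply/negP => /(subsetP sQ1); rewrite inE vS.
  have [c [q [/(subsetP sS1) cS' /(subsetP sQ1) /setDP[qW qS] gcq]]] := jo _ _ dis cS1 cQ1.
  by exists c, q; split; rewrite -?SE.
pose O' := (last x z, head x z) |: ((c, q) |: O).
have sO' : O \subset O' by apply/subsetP => v vO; rewrite !inE vO !orbT.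
have zW v : v \in z -> v \in W by apply: (route_sub rz).
have z0 : z != [::] by case/andP: (route_mem rz); case: (z).
have [||s2 rs2 szs2] := @route_extend W x y (host W O) (host W O') xy (@host_sym W O')
    (fun u v => @host_mono W O O' u v sO') z c q rz _ cz _ qW qz.
- rewrite /host /pair_rel !inE eqxx /=; apply/andP; split; apply: zW.
    by case: (z) z0 => //= a t' _; apply: mem_last.
  by case: (z) z0 => //= a t' _; apply: mem_head.
- by rewrite /host /pair_rel !inE eqxx !orbT zW.
have lez2 := leW _ rz; have lesz := mz _ rs.
have ltz : size z < #|W|.
  by rewrite -cS ltn_neqAle subset_leq_card // andbT; apply: contra neS => /eqP h; rewrite eqEcard SW h /=.
apply: (IH O' s2) => //.
- by rewrite szs2; move: ltk lesz ltz; clear; lia.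
- exact: subset_trans sO sO'.
- by move=> u v; rewrite !inE => /or3P[/eqP[-> ->]|/eqP[-> ->]|/Og].
- have leO' : #|O'| <= 2 + #|O|.
    by rewrite /O' !cardsU1 addnA leq_add2r -[2]/(1 + 1) leq_add ?leq_b1.
  by apply: leq_trans leO' _; rewrite szs2; move: leO lesz; clear; lia.
Qed.

End Routes.

(** * Copies of trees from expansion and boosters *)

Section Gluing.

Variables (V : finType) (g : rel V) (B : {set V}) (m D k : nat) (J : {set V * V}).
Local Notation d := (D + 9).

Hypotheses (m_gt0 : 0 < m) (gsym : symmetric g).
Hypothesis exA : forall X : {set V}, #|X| <= 2 * m -> d * #|X| <= #|nbh g (~: B) X|.
Hypothesis exB : forall X : {set V}, #|X| <= 2 * m -> d * #|X| <= #|nbh g B X|.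
Hypotheses (joJ : joined (pair_rel J) m) (Jg : forall u v, (u, v) \in J -> g u v).
Hypotheses (leJ : #|J| <= k) (leB : (2 * d + 3) * m <= #|B|).
Hypothesis hit : forall (W : {set V}) x y (O : {set V * V}), x != y ->
  #|O| <= 2 * k + d * #|V| + 2 * #|V| ->
  m * m <= 2 * #|boosters W x y (host W O)| ->
  exists r t, g r t /\ [set r; t] \in boosters W x y (host W O).

Lemma pair_rel_sub u v : pair_rel J u v -> g u v.
Proof. by case/orP=> /Jg; rewrite // gsym. Qed.

Lemma joined_sub : joined g m.
Proof.
move=> X Y dXY cX cY; have [x [y [xX yY /pair_rel_sub xy]]] := joJ dXY cX cY.
by exists x, y.
Qed.

Lemma spanning_path (W : {set V}) x y : B \subset W -> x != y -> x \in W -> y \in W ->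
  exists h, [/\ uniq (x :: h), x :: h =i W, last x h = y &
                forall u v, succ_in (x :: h) u v -> g u v].
Proof.
move=> BW xy xW yW.
have [O [leO OB exO]] := sparse_expander m_gt0 gsym exB joJ Jg leB.
apply: (@hamiltonian_path _ g W x y m (2 * k + d * #|V|) O) => //.
- exact: joined_sub.
- by apply: leq_trans leO _; rewrite leq_add2r leq_mul2l leJ.
- by move=> u v /OB[].
(* Discarding neighbours inside [X] still leaves [(d - 1) * #|X|], with [d - 1 >= 8]; this exceeds
   [2 * #|X| + 3] for nonempty [X]. *)
- move=> X XW /andP[X0 Xm]; have leX : #|X| <= 2 * m by lia.
  have := exO X leX; rewrite -(cardsID X (nbh _ _ _)).
  have := subset_leq_card (subsetIr (nbh (arc_rel O) B X) X).
  have : #|nbh (arc_rel O) B X :\: X| <= #|nbh (host W O) (~: X) X|.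
    apply/subset_leq_card/subsetP => z /setDP[/nbhP[zB [v vX vz]] zX].
    apply/nbhP; split; first by rewrite inE.
    by exists v => //; rewrite /host /pair_rel -/(arc_rel O v z) vz (subsetP XW) ?(subsetP BW).
  by move: X0; clear; nia.
- by move=> O' leO'; apply: hit.
Qed.

Lemma tree_copy (T : rel V) x p : is_tree T -> (forall v, degree T v <= D) ->
  bare_path T x p -> #|B| + (2 * D + 3) * m <= size p -> contains_copy g T.
Proof.
move=> treeT degT bareT bigp; have [[Tsym Tirr] con acy] := treeT.
have [Tp up deg2] := bareT.
have p_gt1 : 1 < size p by move: bigp m_gt0; clear; nia.
have VB : #|V| = #|B| + #|~: B| by rewrite cardsC.
have [||f [finj fA fhom]] := @embed_outside_bare_path V g T m D (~: B) x p
    treeT degT bareT p_gt1 m_gt0 gsym joined_sub.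
- move=> X leX; apply: leq_trans (exA leX); by rewrite leq_mul2r leq_add2l orbT.
- by rewrite VB; move: bigp; clear; lia.
set I := [set z in behead (belast x p)] in finj fA fhom *.
set y := last x p.
have ends : [set v in x :: p] :\: I = [set x; y] by apply: interior_ends => //; apply: ltnW.
have endsP v : v \in x :: p -> v \notin I -> v = x \/ v = y.
  move=> vp vI; apply/set2P; rewrite -ends in_setD vI inE.
  exact: vp.
have xI : x \notin I by have := set21 x y; rewrite -ends => /setDP[].
have yI : y \notin I by have := set22 x y; rewrite -ends => /setDP[].
have xy : x != y.
  apply: contraTneq up => xy; rewrite /= negb_and; apply/orP; left.
  by rewrite negbK {1}xy /y; case: (p) p_gt1 => //= a q _; apply: mem_last.
have fxy : f x != f y by apply: contra xy => /eqP /finj -> //; rewrite inE.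
pose S := f @: ~: I.
(* The vertices left for the bare path: those not covered by [f], together with the images of its
   two ends. *)
pose W := [set f x; f y] :|: ~: S.
have BW : B \subset W.
  apply/subsetP => v vB; rewrite inE; apply/orP; right; rewrite inE.
  by apply/imsetP => -[u uI vu]; have := fA u uI; rewrite inE -vu vB.
have [h [uh hW lh gh]] : exists h, [/\ uniq (f x :: h), f x :: h =i W, last (f x) h = f y &
                forall u v, succ_in (f x :: h) u v -> g u v].
  by apply: spanning_path => //; rewrite !inE eqxx ?orbT.
(* The tree spans, so counting uncovered vertices shows that the spanning path of [W] has exactly
   the length of the bare path. *)
have szh : size h = size p.
  have : size (f x :: h) = #|W| by rewrite -(card_uniqP uh); apply: eq_card hW.
  rewrite /W cardsU cards2 fxy (_ : _ :&: _ = set0); last first.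
    apply/setP => v; rewrite !inE; apply/negbTE/negP => /andP[/orP[]/eqP-> /negP[]];
    by apply: imset_f; rewrite inE.
  have := cardsC S; have := cardsC I; rewrite cards0 (interior_card bareT).
  by rewrite (card_in_imset finj) /=; move: p_gt1; clear; lia.
pose phi v := if v \in x :: p then nth (f x) (f x :: h) (index v (x :: p)) else f v.
have phix : phi x = f x by rewrite /phi mem_head /= eqxx.
have phiy : phi y = f y.
  rewrite /phi /y mem_last index_last // -lh -szh; exact: nth_last.
have phiI v : v \notin I -> phi v = f v.
  move=> vI; have [vp|vp] := boolP (v \in x :: p); last by rewrite /phi (negbTE vp).
  by case: (endsP v vp vI) => ->.
have phi_map : map phi (x :: p) = f x :: h.
  apply: (@eq_from_nth _ (f x)); first by rewrite size_map /= szh.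
  move=> i; rewrite size_map => ip; rewrite (nth_map x) // /phi mem_nth //.
  by rewrite index_uniq.
have phi_path : {in x :: p &, injective phi}.
  move=> u v; rewrite /phi => up' vp; rewrite up' vp => /eqP.
  have hsz : size (f x :: h) = size (x :: p) by rewrite /= szh.
  by rewrite nth_uniq ?hsz ?index_mem // => /eqP /index_inj ->.
have Ip v : v \in I -> v \in x :: p by rewrite inE => /interior_sub.
(* [W] meets the image of [f] only in [f x] and [f y], which are already taken by [x] and [y]. *)
have mixed u v : u \in I -> v \notin I -> phi u <> phi v.
  move=> uI vI; rewrite (phiI v) // => uv.
  have uW : phi u \in W by rewrite -hW -phi_map map_f // Ip.
  have /orP[] : (phi u == phi x) || (phi u == phi y).
    move: uW; rewrite phix phiy !inE => /orP[//|/negP[]].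
    by rewrite uv; apply: imset_f; rewrite inE.
  - by move/eqP/(phi_path _ _ (Ip u uI) (mem_head _ _)) => ux; rewrite -ux uI in xI.
  - by move/eqP/(phi_path _ _ (Ip u uI) (mem_last _ _)) => uy; rewrite /y -uy uI in yI.
have adjI u v : u \in I -> T u v -> g (phi u) (phi v).
  rewrite inE => uI /(bare_path_adj Tsym bareT uI) /orP[] /(succ_in_map phi).
    by rewrite phi_map; apply: gh.
  by rewrite phi_map gsym; apply: gh.
exists phi.
  move=> u v uv; have [uI|uI] := boolP (u \in I); have [vI|vI] := boolP (v \in I).
  - by apply: phi_path uv; apply: Ip.
  - by case: (mixed u v uI vI).
  - by case: (mixed v u vI uI).
  - by apply: finj; rewrite ?in_setC // -!phiI.
move=> u v uv; have [uI|uI] := boolP (u \in I); first exact: adjI.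
have [vI|vI] := boolP (v \in I); first by rewrite gsym; apply: adjI; rewrite // Tsym.
by rewrite !phiI //; apply: fhom; rewrite ?in_setC.
Qed.

End Gluing.

(** * Sparse joined subgraphs *)

Section SparseJoined.

Variables (V : finType) (m : nat).
Implicit Types (J : {set V * V}) (p : V * V).

Definition unjoined J : {set {set V} * {set V}} :=
  [set XY : {set V} * {set V} | [&& #|XY.1| == m, #|XY.2| == m, [disjoint XY.1 & XY.2] &
             [forall u in XY.1, forall v in XY.2, ~~ pair_rel J u v]]].

Definition joined_by J p := [set XY in unjoined J | (p.1 \in XY.1) && (p.2 \in XY.2)].

(** The threshold is half the average of [#|joined_by J p|] over all [#|V| ^ 2] ordered pairs
    [p]. *)
Definition efficient J := [set p | m * m * #|unjoined J| <= 2 * #|V| ^ 2 * #|joined_by J p|].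

Definition efficient_edges J : {set {set V}} := [set [set p.1; p.2] | p in efficient J].

Lemma unjoined_eq0 J : unjoined J = set0 -> joined (pair_rel J) m.
Proof.
move=> U0 X Y dXY cX cY; have : (X, Y) \notin unjoined J by rewrite U0 inE.
rewrite inE /= cX cY dXY eqxx /= negb_forall => /existsP[u].
rewrite negb_imply negb_forall => /andP[uX /existsP[v]].
by rewrite negb_imply negbK => /andP[vY uv]; exists u, v.
Qed.

Lemma sum_joined_by J : \sum_p #|joined_by J p| = m * m * #|unjoined J|.
Proof.
under eq_bigr do rewrite -sum1_card; rewrite (exchange_big_dep (mem (unjoined J))) /=; last first.
  by move=> p XY _; rewrite inE => /andP[].
rewrite mulnC -sum_nat_const; apply: eq_bigr => -[X Y] XYU; rewrite sum1_card.
have [/eqP cX /eqP cY] : #|X| == m /\ #|Y| == m by move: XYU; rewrite inE => /and4P[].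
rewrite -{1}cX -cY -cardsX; apply: eq_card => -[u v].
by rewrite -[LHS]/((X, Y) \in joined_by J (u, v)) [LHS]in_set XYU in_setX.
Qed.

(** Inefficient pairs account for at most half of the sum in [sum_joined_by], and an efficient one
    contributes at most [#|unjoined J|]. *)
Lemma efficient_card J : 0 < #|unjoined J| -> m * m <= 2 * #|efficient J|.
Proof.
move=> U0; have := sum_joined_by J; rewrite (bigID (mem (efficient J))) /= => eqS.
have le1 : \sum_(p in efficient J) #|joined_by J p| <= #|efficient J| * #|unjoined J|.
  rewrite -sum_nat_const; apply: leq_sum => p _; apply/subset_leq_card/subsetP => XY.
  by rewrite inE => /andP[].
have le2 : 2 * #|V| ^ 2 * \sum_(p | p \notin efficient J) #|joined_by J p| <=
    #|V| ^ 2 * (m * m * #|unjoined J|).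
  rewrite big_distrr /=; apply: leq_trans (_ : \sum_(p | p \notin efficient J) m * m * #|unjoined J| <= _).
    by apply: leq_sum => p; rewrite inE -ltnNge => /ltnW.
  rewrite sum_nat_const leq_mul2r; apply/orP; right.
  by apply: leq_trans (max_card _) _; rewrite card_prod expnS expn1.
have [V0|V0] := posnP #|V|.
  have /card_gt0P[[X Y]] := U0; rewrite inE => /and4P[/eqP cX _ _ _].
  by have := max_card (mem X); rewrite cX V0 leqn0 => /eqP->.
have le3 : 2 * \sum_(p | p \notin efficient J) #|joined_by J p| <= m * m * #|unjoined J|.
  by rewrite -(@leq_pmul2l (#|V| ^ 2)) ?expn_gt0 ?V0 // mulnA [_ ^ 2 * 2]mulnC.
rewrite -(@leq_pmul2r #|unjoined J|) //.
have arith a c f u : a + c = m * m * u -> a <= f * u -> 2 * c <= m * m * u ->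
  m * m * u <= 2 * f * u by clear; lia.
exact: arith eqS le1 le3.
Qed.

Lemma efficient_edges_card J : 0 < #|unjoined J| -> m * m <= 4 * #|efficient_edges J|.
Proof.
move=> /efficient_card le; apply: leq_trans le _.
by rewrite -[4]/(2 * 2) -mulnA leq_mul2l pairs_card.
Qed.

Lemma unjoinedU1 J p : #|unjoined (p |: J)| + #|joined_by J p| <= #|unjoined J|.
Proof.
have sub : unjoined (p |: J) \subset unjoined J :\: joined_by J p.
  apply/subsetP => -[X Y] XYU; rewrite in_setD.
  move: (XYU); rewrite inE /= => /and4P[cX cY dXY /forallP h].
  have nadj (O : {set V * V}) u v : O \subset p |: J -> u \in X -> v \in Y -> ~~ pair_rel O u v.
    move=> sO uX vY; have /implyP/(_ uX)/forallP/(_ v)/implyP/(_ vY) := h u.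
    by apply: contra => /orP[] /(subsetP sO) uv; rewrite /pair_rel uv ?orbT.
  apply/andP; split.
    rewrite inE /= !negb_and; have [pX|//] := boolP (p.1 \in X); last by rewrite !orbT.
    have [pY|] := boolP (p.2 \in Y); last by rewrite !orbT.
    by have := nadj (p |: J) _ _ (subxx _) pX pY; rewrite /pair_rel -surjective_pairing setU11.
  rewrite inE /= cX cY dXY /=; apply/forallP => u; apply/implyP => uX.
  by apply/forallP => v; apply/implyP => vY; apply: nadj => //; apply: subsetUr.
have sub2 : joined_by J p \subset unjoined J by apply/subsetP => XY; rewrite inE => /andP[].
apply: leq_trans (_ : #|unjoined J :\: joined_by J p| + #|joined_by J p| <= _).
  by rewrite leq_add2r subset_leq_card.
by rewrite -(cardsID (joined_by J p) (unjoined J)) (setIidPr sub2) addnC.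
Qed.

Lemma double_expn_le r k : 0 < r -> 2 ^ k * r ^ (r * k) <= r.+1 ^ (r * k).
Proof.
move=> r0; have bern j : r ^ j * (r + j) <= r * r.+1 ^ j.
  elim: j => [|j IH]; first by rewrite !expn0; lia.
  rewrite !expnS; move: IH; move: (r ^ j) (r.+1 ^ j) => s t IH.
  by apply: leq_trans (_ : r.+1 * (s * (r + j)) <= _); [|move: IH; clear]; nia.
have le : 2 * r ^ r <= r.+1 ^ r.
  rewrite -(leq_pmul2l r0) (leq_trans _ (bern r)) //.
  by rewrite addnn -mul2n; move: (r ^ r); clear; lia.
by rewrite !expnM -expnMn; case: k => // k; rewrite leq_exp2r.
Qed.

(** Greedy choice: every efficient edge joins at least a fraction [1 / r.+1] of the unjoined pairs.
    There are at most [2 ^ (2 * #|V|)] of them at first, and [r] rounds at least halve their number,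
    so [r * (2 * #|V|).+1] rounds leave none. *)
Lemma sparse_joined (g : rel V) (r : nat) : symmetric g ->
  0 < m -> 0 < r -> 2 * #|V| ^ 2 <= r.+1 * (m * m) ->
  (forall J, #|J| <= r * (2 * #|V|).+1 -> 0 < #|unjoined J| ->
     exists u v, g u v /\ [set u; v] \in efficient_edges J) ->
  exists J, [/\ #|J| <= r * (2 * #|V|).+1, forall u v, (u, v) \in J -> g u v &
               joined (pair_rel J) m].
Proof.
move=> gsym m0 r0 ler hit.
suff [J [leJ Jg lt]] : exists J, [/\ #|J| <= r * (2 * #|V|).+1, forall u v, (u, v) \in J -> g u v &
    r.+1 ^ (r * (2 * #|V|).+1) * #|unjoined J| <= r ^ (r * (2 * #|V|).+1) * 2 ^ (2 * #|V|)].
  exists J; split=> //; apply: unjoined_eq0; apply/eqP; rewrite -cards_eq0.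
  have := double_expn_le (2 * #|V|).+1 r0; move: lt; rewrite [in 2 ^ _.+1]expnS.
  have : 0 < r.+1 ^ (r * (2 * #|V|).+1) by rewrite expn_gt0.
  move: (r.+1 ^ _) (r ^ _) (2 ^ _) #|unjoined J| => a c t u; clear; case: u => // u; nia.
set n := r * _; suff loop t : t <= n -> exists J, [/\ #|J| <= t,
    forall u v, (u, v) \in J -> g u v &
    r.+1 ^ t * #|unjoined J| <= r ^ t * 2 ^ (2 * #|V|)] by apply: loop.
elim: t => [_|t IH lt].
  exists set0; split; first by rewrite cards0.
    by move=> u v; rewrite inE.
  rewrite !mul1n; apply: leq_trans (max_card _) _.
  by rewrite card_prod -cardsT -powersetT card_powerset cardsT -expnD addnn mul2n.
have [J [leJ Jg leU]] := IH (ltnW lt).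
have [U0|U0] := posnP #|unjoined J|.
  by exists J; split=> //; [apply: leqW | rewrite U0 muln0].
have [u [v [guv /imsetP[p pE eqp]]]] := hit J (leq_trans leJ (ltnW lt)) U0.
have gp : g p.1 p.2 by case: (set2_eq eqp) => -[<- <-]; rewrite // gsym.
exists (p |: J); split.
- by rewrite cardsU1 -add1n leq_add ?leq_b1.
- move=> a c; rewrite !inE => /predU1P[eqac|/Jg//].
  by rewrite -eqac in gp.
have le1 := unjoinedU1 J p.
have le2 : #|unjoined J| <= r.+1 * #|joined_by J p|.
  move: pE; rewrite inE => h; rewrite -(@leq_pmul2l (m * m)) ?muln_gt0 ?m0 //.
  apply: leq_trans h _; rewrite mulnA leq_mul2r mulnC; apply/orP; right.
  by rewrite mulnC [_ * r.+1]mulnC.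
rewrite !expnS; apply: leq_trans (_ : r * (r.+1 ^ t * #|unjoined J|) <= _).
  have le3 : r.+1 * #|unjoined (p |: J)| <= r * #|unjoined J|.
    have arith a c h : a + h <= c -> c <= r.+1 * h -> r.+1 * a <= r * c by clear; nia.
    exact: arith le1 le2.
  by rewrite mulnAC [leqRHS]mulnCA [leqRHS]mulnC leq_mul2r le3 orbT.
by rewrite -mulnA leq_mul2l leU orbT.
Qed.

End SparseJoined.

(** * Families that Maker hits *)

Lemma card_small_sets (T : finType) k :
  #|[set S : {set T} | #|S| <= k]| <= #|T|.+1 ^ k.
Proof.
(* A set of at most [k] elements is listed by [k] entries, with [None] as padding. *)
pose F (f : {ffun 'I_k -> option T}) := [set t | Some t \in codom f].
have sub : [set S : {set T} | #|S| <= k] \subset [set F f | f in setT].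
  apply/subsetP => S; rewrite inE => leS; apply/imsetP.
  exists [ffun i : 'I_k => nth None (map Some (enum S)) i] => //.
  apply/setP => t; rewrite inE; apply/idP/codomP => [tS|[i]].
    have lti : index t (enum S) < k.
      by apply: leq_trans leS; rewrite cardE index_mem mem_enum.
    exists (Ordinal lti); rewrite ffunE (nth_map t) ?nth_index ?mem_enum //.
    by rewrite index_mem mem_enum.
  rewrite ffunE => Et; have [lti|gei] := ltnP i (size (enum S)).
    by move: Et; rewrite (nth_map t) // => -[->]; rewrite -mem_enum mem_nth.
  by rewrite nth_default ?size_map in Et.
apply: leq_trans (subset_leq_card sub) _; apply: leq_trans (leq_imset_card _ _) _.
by rewrite cardsT card_ffun card_option card_ord.
Qed.

Lemma sum_decay_le b (I : finType) (P : pred I) (F : I -> nat) N j :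
  #|[set i | P i]| <= 2 ^ N -> (forall i, P i -> 2 * b.+1 * (N + j) <= F i) ->
  (\sum_(i | P i) decay b ^+ F i <= (2 ^+ j)^-1)%R.
Proof.
move=> cP leF; apply: (@le_trans _ _ (\sum_(i | P i) (2 ^+ (N + j))^-1)%R).
  by apply: ler_sum => i /leF; apply: decay_exp_le.
rewrite sumr_const -[(_ *+ _)%R]mulr_natl exprD invfM mulrA.
rewrite ler_piMl ?invr_ge0 ?exprn_ge0 // ler_pdivrMr ?exprn_gt0 // mul1r.
by rewrite -natrX ler_nat -cardsE.
Qed.

Lemma boosters_card2 (V : finType) (W : {set V}) x y e E :
  x != y -> E \in boosters W x y e -> #|E| = 2.
Proof.
move=> xy; rewrite inE => /asboolP[s [[rs _] ->]]; rewrite cards2.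
have [xs ys] := andP (route_mem rs); have := route_uniq rs.
case: s xs ys {rs} => // a [|c s]; first by rewrite !inE => /eqP ax /eqP ay; rewrite ax ay eqxx in xy.
move=> _ _ /andP[+ _] /=; rewrite inE negb_or => /andP[ac as_].
suff -> : a != last c s by [].
by apply: contraTneq (mem_last c s) => <-; rewrite inE negb_or ac as_.
Qed.

Section Universality.

Variables (n b m D M l : nat).
Local Notation d := (D + 9).
(** [r] is such that [n <= 2 * M * m] gives [2 * n ^ 2 <= r * (m * m)]. [kJ] is the number of greedy
    rounds, and [kO] bounds a sparse expander built over such a [J] plus two arcs per round of route
    extension. *)
Local Notation r := (8 * (M * M)).
Local Notation kJ := (r * (2 * n).+1).
Local Notation kO := (2 * kJ + d * n + 2 * n).
Local Notation V := 'I_n.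

(* Large enough for each of the three families to have total weight at most
   [1/8]. *)
Definition load := 4 * (2 * M + 5 + 24 * (r * M) + 4 * M * (d + 2)) + d + 6.

Hypotheses (m_gt0 : 0 < m) (M_gt0 : 0 < M) (l_gt0 : 0 < l) (n_lt : n < 2 ^ l).
Hypotheses (m_le : 8 * d.+1 * m <= n) (n_le : n <= 2 * M * m).
Hypothesis bias : 2 * b.+1 * load * l <= m.

Definition reserve : {set V} := [set i : V | i < 4 * d.+1 * m].
Definition side (s : bool) : {set V} := if s then reserve else ~: reserve.

Lemma card_reserve : #|reserve| = 4 * d.+1 * m.
Proof.
have le : 4 * d.+1 * m <= n by apply: leq_trans m_le; rewrite !leq_mul2r orbT.
have -> : reserve = [set widen_ord le i | i in setT].
  apply/setP => i; rewrite inE; apply/idP/imsetP => [lti|[j _ ->]]; last by rewrite /=.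
  by exists (Ordinal lti) => //; apply: val_inj.
by rewrite card_imset ?cardsT ?card_ord // => i j /(congr1 val) /= ?; apply: val_inj.
Qed.

Lemma card_side s : 4 * d.+1 * m <= #|side s|.
Proof.
case: s => /=; first by rewrite card_reserve.
have := cardsC reserve; rewrite card_reserve card_ord.
have arith z : 4 * d.+1 * m + z = n -> 4 * d.+1 * m <= z by move: m_le; clear; lia.
exact: arith.
Qed.

Definition expansion_edges (i : bool * ({set V} * {set V})) : {set {set V}} :=
  [set [set p.1; p.2] | p in setX i.2.1 (side i.1 :\: (i.2.1 :|: i.2.2))].

(** The second set stands for a neighbourhood that would be too small; an edge of Maker leaving it
    refutes this candidate. *)
Definition expansion_index (i : bool * ({set V} * {set V})) :=
  [&& 0 < #|i.2.1|, #|i.2.1| <= 2 * m & #|i.2.2| <= d * #|i.2.1|].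

(** Removing at most [2 * m + 2 * d * m] vertices from a side leaves at least [2 * m]; half is lost
    in passing to unordered pairs. *)
Lemma card_expansion_edges i : expansion_index i -> #|i.2.1| * m <= #|expansion_edges i|.
Proof.
case: i => s [X Y] /and3P[/= X0 leX leY].
have := pairs_card (setX X (side s :\: (X :|: Y))); rewrite cardsX -/(expansion_edges (s, (X, Y))).
set Z := side s :\: _; have leZ : 2 * m <= #|Z|.
  have := cardsID (X :|: Y) (side s); rewrite -/Z.
  have := subset_leq_card (subsetIr (side s) (X :|: Y)).
  have [+ _] := leq_card_setU X Y; have := card_side s.
  have arith a c z s' u w : 4 * d.+1 * m <= s' -> u <= a + c -> w <= u -> w + z = s' ->
    a <= 2 * m -> c <= d * a -> 2 * m <= z by clear; nia.
  by move=> h1 h2 h3 h4; apply: arith h1 h2 h3 h4 leX leY.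
have arith a z e : 2 * m <= z -> a * z <= 2 * e -> a * m <= e by clear; nia.
exact: arith leZ.
Qed.

(** The sets are grouped by the size [k] of [X], as both their number and their size grow with [k].
    Each [k] contributes at most [2 ^ -(l + 3)], and there are at most [2 ^ l] values of [k]. *)
Lemma sum_expansion : (\sum_(i | expansion_index i) decay b ^+ #|expansion_edges i| <= 8^-1)%R.
Proof.
pose sz (i : bool * ({set V} * {set V})) : 'I_(2 * m).+1 := inord #|i.2.1|.
rewrite (partition_big sz predT) //=.
apply: (@le_trans _ _ (\sum_(k < (2 * m).+1) (2 ^+ (l + 3))^-1)%R); last first.
  rewrite sumr_const card_ord -[(_ *+ _)%R]mulr_natl exprD invfM mulrA.
  have -> : (2 ^+ 3 = 8 :> rat)%R by [].
  rewrite ler_piMl ?invr_ge0 // ler_pdivrMr ?exprn_gt0 // mul1r -natrX ler_nat.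
  apply: leq_trans n_lt; rewrite ltnS; apply: leq_trans m_le; rewrite leq_mul2r.
  by apply/orP; right; clear; lia.
apply: ler_sum => k _; have szP i : expansion_index i -> sz i == k -> #|i.2.1| = k.
  by move=> /and3P[_ leX _] /eqP <-; rewrite inordK.
have [k0|k_gt0] := posnP k.
  rewrite big1 ?invr_ge0 ?exprn_ge0 // => i /andP[iP /(szP i iP)]; rewrite k0 => i0.
  by move: iP; rewrite /expansion_index i0.
apply: (@sum_decay_le _ _ _ _ (1 + l * (d.+1 * k))).
  apply: leq_trans (_ : #|setX [set: bool] (setX [set X : {set V} | #|X| <= k]
      [set X : {set V} | #|X| <= d * k])| <= _).
    apply/subset_leq_card/subsetP => -[s [X Y]]; rewrite inE => /andP[iP /(szP _ iP) /= cX].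
    by case/and3P: iP => /= _ _ cY; rewrite !in_setX !inE cX leqnn -cX.
  rewrite !cardsX cardsT card_bool expnD expn1 leq_mul2l /= expnM.
  have -> : (2 ^ l) ^ (d.+1 * k) = (2 ^ l) ^ k * (2 ^ l) ^ (d * k) by rewrite -expnD.
  apply: leq_mul; apply: leq_trans (card_small_sets _ _) _; rewrite card_ord.
    by case: (k : nat) => // j; rewrite leq_exp2r.
  by case: (_ * _) => // j; rewrite leq_exp2r.
move=> i /andP[iP /(szP i iP) cX]; apply: leq_trans (card_expansion_edges iP); rewrite cX.
apply: leq_trans (_ : k * (2 * b.+1 * load * l) <= _); last by rewrite leq_mul2l bias orbT.
rewrite [k * _]mulnC -!mulnA leq_mul2l /= leq_mul2l; apply/orP; right.
have : d + 6 <= load by rewrite /load leq_add2r leq_addl.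
by move: l_gt0 k_gt0; move: load (nat_of_ord k) => q k'; clear; nia.
Qed.

Lemma card_small_arcs k : #|[set O : {set V * V} | #|O| <= k]| <= 2 ^ (2 * l * k).
Proof.
apply: leq_trans (card_small_sets _ _) _; rewrite card_prod card_ord expnM.
case: k => // k; rewrite leq_exp2r // mulnC expnM expnS expn1.
by move: n_lt; move: (2 ^ l) => t; clear; nia.
Qed.

Lemma kJ_le : kJ <= 5 * (r * M) * m.
Proof.
have Mm : 0 < M * m by rewrite muln_gt0 M_gt0.
have le : (2 * n).+1 <= 5 * (M * m).
  by move: n_le Mm; rewrite -mulnA; move: (M * m) => t; clear; lia.
apply: leq_trans (_ : r * (5 * (M * m)) <= _); first by rewrite leq_mul2l le orbT.
by move: (8 * (M * M)) => q; clear; lia.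
Qed.

Lemma kO_le : kO <= (10 * (r * M) + 2 * M * (d + 2)) * m.
Proof.
have := kJ_le; move: kJ (r * M) => k rM lek.
have : (d + 2) * n <= (d + 2) * (2 * M * m) by rewrite leq_mul2l n_le orbT.
by move: lek; clear; lia.
Qed.

Definition joining_index (J : {set V * V}) := (#|J| <= kJ) && (0 < #|unjoined m J|).

Lemma bias_square N : 4 * (N + 3) <= load * l * m -> 4 * (2 * b.+1 * (N + 3)) <= m * m.
Proof.
move=> leN; apply: leq_trans (_ : 2 * b.+1 * load * l * m <= _); last by rewrite leq_mul2r bias orbT.
by rewrite mulnCA -!mulnA leq_mul2l /= leq_mul2l /= !mulnA.
Qed.

Lemma sum_joining :
  (\sum_(J | joining_index J) decay b ^+ #|efficient_edges m J| <= 8^-1)%R.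
Proof.
have -> : (8 = 2 ^+ 3 :> rat)%R by [].
apply: (@sum_decay_le _ _ _ _ (2 * l * kJ)).
  apply: leq_trans (card_small_arcs kJ); apply/subset_leq_card/subsetP => J.
  by rewrite !inE => /andP[].
move=> J /andP[_ U0]; rewrite -(@leq_pmul2l 4) //.
apply: leq_trans (efficient_edges_card U0); apply: bias_square.
have : 40 * (r * M) + 12 <= load by rewrite /load; clear; lia.
have := kJ_le; move: kJ load (r * M) m_gt0 l_gt0 => k q rM; clear; move=> m0 l0 lek leq_.
apply: (@leq_trans ((40 * rM + 12) * l * m)); last by rewrite !leq_mul2r leq_ !orbT.
have : l * k <= l * (5 * rM * m) by rewrite leq_mul2l lek orbT.
have : 0 < l * m by rewrite muln_gt0 l0.
have -> : l * (5 * rM * m) = 5 * (rM * (l * m)) by clear; lia.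
have -> : (40 * rM + 12) * l * m = 40 * (rM * (l * m)) + 12 * (l * m) by clear; lia.
by clear; lia.
Qed.

Definition booster_index (i : ({set V} * (V * V)) * {set V * V}) :=
  [&& i.1.2.1 != i.1.2.2, #|i.2| <= kO &
      m * m <= 2 * #|boosters i.1.1 i.1.2.1 i.1.2.2 (host i.1.1 i.2)|].

Lemma sum_boosters : (\sum_(i | booster_index i)
  decay b ^+ #|boosters i.1.1 i.1.2.1 i.1.2.2 (host i.1.1 i.2)| <= 8^-1)%R.
Proof.
have -> : (8 = 2 ^+ 3 :> rat)%R by [].
(* The three terms count the bits needed for [W], for the pair [(x, y)] and for [O]. *)
apply: (@sum_decay_le _ _ _ _ (n + 2 * l + 2 * l * kO)).
  apply: leq_trans (_ : #|setX [set: {set V} * (V * V)] [set O : {set V * V} | #|O| <= kO]| <= _).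
    by apply/subset_leq_card/subsetP => -[W O]; rewrite !inE => /and3P[].
  rewrite cardsX cardsT card_prod card_prod card_ord.
  rewrite -cardsT -powersetT card_powerset cardsT card_ord.
  rewrite expnD leq_mul ?card_small_arcs // expnD leq_mul2l; apply/orP; right.
  by rewrite mulnC expnM expnS expn1 leq_mul // ltnW.
move=> i /and3P[_ _ leb]; rewrite -(@leq_pmul2l 2) //.
apply: leq_trans leb; apply: leq_trans (_ : 4 * (2 * b.+1 * (n + 2 * l + 2 * l * kO + 3)) <= _).
  by rewrite leq_mul2r orbT.
apply: bias_square.
have : 4 * (2 * M + 5 + 20 * (r * M) + 4 * M * (d + 2)) <= load by rewrite /load; clear; lia.
have := kO_le; move: kO load (r * M) m_gt0 l_gt0 n_le => k q rM; clear; move=> m0 l0 len lek leq_.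
apply: (@leq_trans (4 * (2 * M + 5 + 20 * rM + 4 * M * (d + 2)) * l * m)); last first.
  by rewrite !leq_mul2r leq_ !orbT.
rewrite -!mulnA leq_mul2l /=.
have : l * k <= l * ((10 * rM + 2 * M * (d + 2)) * m) by rewrite leq_mul2l lek orbT.
have lm : l <= l * m by rewrite leq_pmulr.
have : n <= 2 * (M * (l * m)).
  by apply: leq_trans len _; rewrite -mulnA !leq_mul2l /= leq_pmull ?orbT.
move: (d + 2) => d2.
by move: l0 lm; clear; lia.
Qed.

Definition game_index (i : (bool * ({set V} * {set V}) + {set V * V}) +
    ({set V} * (V * V)) * {set V * V}) : bool :=
  match i with
  | inl (inl i1) => expansion_index i1
  | inl (inr i2) => joining_index i2
  | inr i3 => booster_index i3
  end.

Definition game_edges (i : (bool * ({set V} * {set V}) + {set V * V}) +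
    ({set V} * (V * V)) * {set V * V}) : {set {set V}} :=
  match i with
  | inl (inl i1) => expansion_edges i1
  | inl (inr i2) => efficient_edges m i2
  | inr i3 => boosters i3.1.1 i3.1.2.1 i3.1.2.2 (host i3.1.1 i3.2)
  end.

Lemma game_edges_board i : game_index i -> game_edges i \subset board n.
Proof.
case: i => [[[s [X Y]]|J]|[[W [x y]] O]] /= iP; apply/subsetP => E.
- case/imsetP=> -[u v] /=; rewrite !inE /= negb_or => /and3P[uX /andP[vX _] _] ->.
  have uv : u != v by apply: contraNneq vX => <-.
  by rewrite cards2 uv.
- case/imsetP=> -[u v] uvE -> /=; rewrite inE cards2.
  suff -> : u != v by [].
  (* A loop joins no two disjoint sets, so it is not efficient while some pair is unjoined. *)
  apply/eqP => uv; case/andP: iP => _ U0; move: uvE; rewrite uv inE.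
  have -> : joined_by m J (v, v) = set0.
    apply/setP => -[X Y]; rewrite !inE /=; apply/negbTE/negP => /andP[/and4P[_ _ dis _] /andP[vX vY]].
    by rewrite (disjointFr dis vX) in vY.
  by rewrite cards0 muln0 leqNgt !muln_gt0 m_gt0 U0.
- by case/and3P: iP => xy _ _ /(boosters_card2 xy) cE; rewrite inE cE.
Qed.

Lemma maker_can_build_mono starter (P Q : rel V -> Prop) : (forall G, P G -> Q G) ->
  maker_can_build b starter P -> maker_can_build b starter Q.
Proof.
move=> PQ [s [s1 s2]]; exists s; split=> // t q h pl un0.
by apply: PQ; apply: s2 pl un0.
Qed.

Lemma maker_universal starter : maker_can_build b starter (fun G : rel V =>
  forall (T : rel V) x p, is_tree T -> (forall v, degree T v <= D) ->
    bare_path T x p -> 8 * d.+1 * m <= size p -> contains_copy G T).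
Proof.
apply: (maker_can_build_mono _ (maker_hits starter game_edges_board _)); last first.
  rewrite !big_sumType /=.
  by have := sum_expansion; have := sum_joining; have := sum_boosters; lra.
move=> g [gsym hit] T x p treeT degT bareT lep.
have ex s (X : {set V}) : #|X| <= 2 * m -> d * #|X| <= #|nbh g (side s) X|.
  move=> leX; rewrite leqNgt; apply/negP => lt.
  have [X0|X0] := posnP #|X|; first by rewrite X0 muln0 in lt.
  (* The family is applied to the actual neighbourhood of [X]; the edge hit would end outside it. *)
  have [|u [v [guv]]] := hit (inl (inl (s, (X, nbh g (side s) X)))).
    by rewrite /= /expansion_index /= X0 leX ltnW.
  case/imsetP=> -[a c] /=; rewrite in_setX in_setD in_setU negb_or.
  case/andP=> /= aX /andP[/andP[_ cN] cs] eqE; case/negP: cN; apply/nbhP; split=> //.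
  by exists a => //; case: (set2_eq eqE) => -[<- <-]; rewrite // gsym.
have [|||J [leJ Jg joJ]] := @sparse_joined V m g r gsym m_gt0.
- by rewrite !muln_gt0 M_gt0.
- rewrite card_ord; apply: leq_trans (_ : 2 * (2 * M * m) ^ 2 <= _).
    by rewrite leq_mul2l leq_exp2r.
  have -> : 2 * (2 * M * m) ^ 2 = 8 * (M * M) * (m * m) by rewrite expnS expn1; clear; lia.
  by rewrite leq_mul2r leqnSn orbT.
- move=> J; rewrite card_ord => leJ U0.
  by apply: (hit (inl (inr J))); rewrite /= /joining_index leJ.
rewrite card_ord in leJ.
apply: (@tree_copy V g reserve m D kJ J _ _ _ _ _ _ _ _ _ T x p) => //.
- exact: (ex false).
- exact: (ex true).
- by rewrite card_reserve leq_mul2r; apply/orP; right; clear; lia.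
- move=> W u v O uv; rewrite card_ord => leO leb.
  by apply: (hit (inr ((W, (u, v)), O))); rewrite /= /booster_index /= uv leO.
- rewrite card_reserve; apply: leq_trans lep; rewrite -mulnDl leq_mul2r.
  by apply/orP; right; clear; lia.
Qed.

End Universality.

(** * The choice of constants *)

Lemma mul_log_le C : exists n0, forall n, n0 <= n -> C * (trunc_log 2 n).+1 <= n.
Proof.
(* If the logarithm is below [2 * C], this threshold suffices; otherwise [k * k.+1 <= 2 * 2 ^ k]
   does. *)
exists (C * (2 * C).+1 + 1) => n len; set L := trunc_log 2 n.
have leL : 2 ^ L <= n by apply: trunc_logP => //; move: len; clear; lia.
have [ltL|geL] := ltnP L (2 * C).
  apply: leq_trans len; apply: leq_trans (leq_addr _ _).
  by rewrite leq_mul2l ltnS (ltnW ltL) orbT.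
apply: leq_trans leL; have sq k : k * k.+1 <= 2 * 2 ^ k.
  case: k => [|[|k]] //; elim: k => // k IH; rewrite [2 ^ k.+3]expnS.
  by move: IH; move: (2 ^ _) => t; clear; nia.
by have := sq L; move: geL; move: (2 ^ L) => t; clear; nia.
Qed.

Local Open Scope ring_scope.

Theorem theorem1p8 (R : realType) (alpha Delta : R) :
  0 < alpha -> 0 < Delta ->
  exists2 delta : R, 0 < delta &
  exists n0 : nat, forall n : nat, (n0 <= n)%N ->
  forall b : nat, b%:R <= delta * n%:R / ln (n%:R : R) ->
  forall starter : player,
  maker_can_build b starter (fun G : rel 'I_n =>
    forall T : rel 'I_n, is_tree T ->
      (max_degree T)%:R <= Delta ->
      (exists (x : 'I_n) (p : seq 'I_n),
         bare_path T x p /\ alpha * n%:R <= (size p)%:R) ->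
      contains_copy G T).
Proof.
move=> alpha_gt0 Delta_gt0.
have [a a_gt0 alpha_a] : exists2 a, (0 < a)%N & 1 <= alpha * a%:R.
  have iv : 0 <= alpha^-1 by rewrite invr_ge0 ltW.
  have lt := archi_boundP iv; exists (Num.bound alpha^-1).
    by rewrite -(ltr0n R) (le_lt_trans iv lt).
  by rewrite mulrC -ler_pdivrMr // div1r ltW.
pose D := Num.bound Delta.
have leD : Delta <= D%:R by apply/ltW/archi_boundP/ltW.
(* With [m = n / M] rounded down, the length [8 * (D + 9).+1 * m] needed for the bare path is at
   most [n / a <= alpha * n]. *)
have [M defM] : exists M, M = (a * (8 * (D + 9).+1))%N by eexists.
have M_gt0 : (0 < M)%N by rewrite defM !muln_gt0 a_gt0.
have [Q defQ] : exists Q, Q = load D M by eexists.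
have Q_gt0 : (0 < Q)%N by rewrite defQ /load addnS.
have [K defK] : exists K, K = (16 * M * Q)%N by eexists.
have K_gt0 : (0 < K)%N by rewrite defK !muln_gt0 M_gt0 Q_gt0.
have ln2_gt0 : 0 < ln (2 : R) by rewrite ln_gt0 // ltr1n.
exists (ln 2 / K%:R); first by rewrite divr_gt0 ?ltr0n.
have [n1 n1P] := mul_log_le K.
exists (n1 + M + 2)%N => n len b leb starter.
have n_ge2 : (2 <= n)%N by move: len; clear; lia.
have n_geM : (M <= n)%N by move: len; clear; lia.
set L := trunc_log 2 n.
have leL : (K * L.+1 <= n)%N by apply: n1P; move: len; clear; lia.
have n_gt1 : 1 < n%:R :> R by rewrite ltr1n.
have lnn : L%:R * ln (2 : R) <= ln n%:R.
  rewrite mulr_natl -lnXn // ler_ln ?posrE ?exprn_gt0 ?ltr0n //; last by apply: ltnW.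
  by rewrite -natrX ler_nat trunc_logP // ltnW.
(* As [L * ln 2 <= ln n], the choice [delta = ln 2 / K] turns the bound on [b] into one on natural
   numbers. *)
have bL : (K * b * L <= n)%N.
  rewrite -(ler_nat R) 2!natrM.
  have lnn_gt0 : 0 < ln (n%:R : R) by rewrite ln_gt0.
  move: leb; rewrite ler_pdivlMr // => leb.
  rewrite -(ler_pM2r ln2_gt0) -!mulrA mulrC -ler_pdivlMr ?ltr0n //.
  apply: le_trans (_ : b%:R * ln n%:R <= _); first by rewrite ler_wpM2l.
  by apply: le_trans leb _; rewrite [_ / _ * _]mulrAC [ln 2 * _]mulrC.
pose m := (n %/ M)%N.
have m_gt0 : (0 < m)%N by rewrite divn_gt0.
have Mm_le : (M * m <= n)%N by rewrite mulnC leq_divM.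
have n_leMm : (n <= 2 * M * m)%N.
  have := ltn_ceil n M_gt0; rewrite -/m; move: M_gt0 m_gt0; clear; nia.
have L_gt0 : (0 < L)%N by rewrite trunc_log_gt0.
have bias : (2 * b.+1 * Q * L.+1 <= m)%N.
  (* The terms for 1 and for [b] in [b.+1] each take at most [n], and [2 * n <= 4 * M * m]. The 16
     in [K] is 8 doubled, because [L.+1 <= 2 * L]. *)
  rewrite -(@leq_pmul2l (4 * M)) ?muln_gt0 //.
  have le1 : (8 * M * Q * L.+1 <= n)%N.
    by apply: leq_trans leL; rewrite leq_mul2r defK -!mulnA leq_mul2r orbT.
  have le2 : (8 * M * Q * b * L.+1 <= n)%N.
    apply: leq_trans bL; rewrite defK; move: L_gt0; clear.
    have -> : (8 * M * Q * b * L.+1 = 8 * (M * Q * b) * L.+1)%N by clear; lia.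
    have -> : (16 * M * Q * b * L = 16 * (M * Q * b) * L)%N by clear; lia.
    by move: (M * Q * b)%N => t; clear; nia.
  move: le1 le2 n_leMm; clear; nia.
apply: maker_can_build_mono (@maker_universal n b m D M L.+1 _ _ _ _ _ _ _ starter) => //.
- move=> G univ T treeT leT [x [p [bareT lep]]]; apply: (univ T x p) => //.
  + move=> v; rewrite -(ler_nat R); apply: le_trans leD; apply: le_trans leT.
    by rewrite ler_nat /max_degree (leq_bigmax v).
  + rewrite -(@leq_pmul2l a) // mulnA -defM; apply: leq_trans Mm_le _.
    rewrite -(ler_nat R) natrM; apply: le_trans (_ : a%:R * (alpha * n%:R) <= _).
      by rewrite mulrA [a%:R * _]mulrC ler_peMl.
    by rewrite ler_wpM2l.
- by apply: trunc_log_ltn.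
- by apply: leq_trans Mm_le; rewrite leq_mul2r defM leq_pmull ?orbT.
- by rewrite -defQ.
Qed.
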